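(* Let $\mathfrak{g}$ be a finite-dimensional superspace and let $(\mathfrak{g},[\cdot,\cdot]_{\mathfrak{g}},\alpha_{\mathfrak{g}})$ and $(\mathfrak{g}^*,[\cdot,\cdot]_{\mathfrak{g}^*},\alpha_{\mathfrak{g}}^* )$ be two admissible multiplicative Hom-Lie superalgebras. Then the following conditions are equivalent. (1) $(\mathfrak{g},\mathfrak{g}^* )$ is a Hom-Lie superbialgebra in the sense of conditions (C1) and (C2) of the context. (2) $(\mathfrak{g},\mathfrak{g}^*,ad^*,\mathfrak{ad}^* )$ is a matched pair of Hom-Lie superalgebras. (3) $(\mathfrak{g}\oplus\mathfrak{g}^*,\mathfrak{g},\mathfrak{g}^* )$ is a Manin supertriple of Hom-Lie superalgebras with the invariant bilinear form $S(x+\xi,y+\eta)=\langle x,\eta\rangle+\langle\xi,y\rangle$; that is, there is a Hom-Lie superalgebra structure on the superspace $\mathfrak{g}\oplus\mathfrak{g}^*$ for which $\mathfrak{g}$ and $\mathfrak{g}^*$, with their given structures, are Hom-Lie sub-superalgebras and which together with $S$ forms a Manin supertriple.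
   Context: $\mathbb{K}$ is a field of characteristic $0$; superspaces are $\mathbb{Z}_2$-graded; $|x|$ is the parity of a homogeneous $x$. A Hom-Lie superalgebra $(\mathfrak{L},[\cdot,\cdot],\alpha)$ is a superspace with an even bilinear bracket and an even linear map $\alpha$ such that $[x,y]=-(-1)^{|x||y|}[y,x]$ and $(-1)^{|x||z|}[\alpha(x),[y,z]]+(-1)^{|z||y|}[\alpha(z),[x,y]]+(-1)^{|y||x|}[\alpha(y),[z,x]]=0$; it is multiplicative if $\alpha([x,y])=[\alpha(x),\alpha(y)]$; it is admissible if $[(\mathrm{Id}-\alpha^2)(x),\alpha(y)]=0$ for all $x,y$. A representation of $\mathfrak{L}$ on a superspace $M$ with respect to $A\in\mathfrak{gl}(M)$ is an even linear map $\rho:\mathfrak{L}\to\mathrm{End}(M)$ with $\rho(\alpha(x))A=A\rho(x)$ and $\rho([x,y])A=\rho(\alpha(x))\rho(y)-(-1)^{|x||y|}\rho(\alpha(y))\rho(x)$. A matched pair $(\mathfrak{g},\mathfrak{g}',\rho,\rho')$ of Hom-Lie superalgebras consists of Hom-Lie superalgebras $(\mathfrak{g},[\cdot,\cdot]_{\mathfrak{g}},\alpha_{\mathfrak{g}})$, $(\mathfrak{g}',[\cdot,\cdot]_{\mathfrak{g}'},\alpha_{\mathfrak{g}'})$ and representations $\rho$ of $\mathfrak{g}$ on $\mathfrak{g}'$ with respect to $\alpha_{\mathfrak{g}'}$ and $\rho'$ of $\mathfrak{g}'$ on $\mathfrak{g}$ with respect to $\alpha_{\mathfrak{g}}$ such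 that for homogeneous elements $\rho(\alpha_{\mathfrak{g}}(z))([x',y']_{\mathfrak{g}'})=[\rho(z)(x'),\alpha_{\mathfrak{g}'}(y')]_{\mathfrak{g}'}+(-1)^{|x'||z|}[\alpha_{\mathfrak{g}'}(x'),\rho(z)(y')]_{\mathfrak{g}'}+(-1)^{|x'||y'|+|y'||z|}\rho(\rho'(y')(z))(\alpha_{\mathfrak{g}'}(x'))-(-1)^{|x'||z|}\rho(\rho'(x')(z))(\alpha_{\mathfrak{g}'}(y'))$ and $\rho'(\alpha_{\mathfrak{g}'}(z'))([x,y]_{\mathfrak{g}})=[\rho'(z')(x),\alpha_{\mathfrak{g}}(y)]_{\mathfrak{g}}+(-1)^{|x||z'|}[\alpha_{\mathfrak{g}}(x),\rho'(z')(y)]_{\mathfrak{g}}+(-1)^{|x||y|+|y||z'|}\rho'(\rho(y)(z'))(\alpha_{\mathfrak{g}}(x))-(-1)^{|x||z'|}\rho'(\rho(x)(z'))(\alpha_{\mathfrak{g}}(y))$. Pairing and coadjoint maps: $\langle\xi,x\rangle=\xi(x)$ and $\langle x,\xi\rangle=(-1)^{|x||\xi|}\langle\xi,x\rangle$ for $x\in\mathfrak{g}$, $\xi\in\mathfrak{g}^*$; $\alpha_{\mathfrak{g}}^*(\xi)=\xi\circ\alpha_{\mathfrak{g}}$. With $ad_x(y)=[x,y]_{\mathfrak{g}}$ and $\mathfrak{ad}_\xi(\eta)=[\xi,\eta]_{\mathfrak{g}^*}$, the maps $ad^*_x:\mathfrak{g}^*\to\mathfrak{g}^*$ and $\mathfrak{ad}^*_\xi:\mathfrak{g}\to\mathfrak{g}$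 are defined by $\langle ad_x(y),\xi\rangle=-(-1)^{|x||y|}\langle y,ad^*_x(\xi)\rangle$ and $\langle\mathfrak{ad}_\xi(\eta),x\rangle=-(-1)^{|\xi||\eta|}\langle\eta,\mathfrak{ad}^*_\xi(x)\rangle$. They extend to $\wedge^2$ by $ad^*_x(\xi\wedge\eta)=ad^*_x(\xi)\wedge\alpha_{\mathfrak{g}}^*(\eta)+(-1)^{|x||\xi|}\alpha_{\mathfrak{g}}^*(\xi)\wedge ad^*_x(\eta)$ and $\mathfrak{ad}^*_\xi(x\wedge y)=\mathfrak{ad}^*_\xi(x)\wedge\alpha_{\mathfrak{g}}(y)+(-1)^{|\xi||x|}\alpha_{\mathfrak{g}}(x)\wedge\mathfrak{ad}^*_\xi(y)$. The dual maps $\Delta:\mathfrak{g}\to\wedge^2\mathfrak{g}$ and $\Delta^*:\mathfrak{g}^*\to\wedge^2\mathfrak{g}^*$ are given by $\langle\Delta(x),\xi\wedge\eta\rangle=\langle x,[\xi,\eta]_{\mathfrak{g}^*}\rangle$ and $\langle\Delta^*(\xi),x\wedge y\rangle=\langle\xi,[x,y]_{\mathfrak{g}}\rangle$. On $\wedge^2$, $ad_x$ and $\mathfrak{ad}_\xi$ pair by the same duality: $\langle ad_x(P),\Xi\rangle=-(-1)^{|x||P|}\langle P,ad^*_x(\Xi)\rangle$ for $P\in\wedge^2\mathfrak{g}$, $\Xi\in\wedge^2\mathfrak{g}^*$, and symmetrically for $\mathfrak{ad}_\xi$ on $\wedge^2\mathfrak{g}^*$. $(\mathfrak{g},\mathfrak{g}^*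 )$ is a Hom-Lie superbialgebra if for all homogeneous $x,y\in\mathfrak{g}$, $\xi,\eta\in\mathfrak{g}^*$: (C1) $\langle\Delta([x,y]_{\mathfrak{g}}),\alpha_{\mathfrak{g}}^*(\xi)\wedge\eta\rangle=\langle ad_{\alpha_{\mathfrak{g}}(x)}(\Delta(y)),\alpha_{\mathfrak{g}}^*(\xi)\wedge\eta\rangle-(-1)^{|x||y|}\langle ad_{\alpha_{\mathfrak{g}}(y)}(\Delta(x)),\alpha_{\mathfrak{g}}^*(\xi)\wedge\eta\rangle$; (C2) $\langle\Delta^*([\xi,\eta]_{\mathfrak{g}^*}),\alpha_{\mathfrak{g}}(x)\wedge y\rangle=\langle\mathfrak{ad}_{\alpha_{\mathfrak{g}}^*(\xi)}(\Delta^*(\eta)),\alpha_{\mathfrak{g}}(x)\wedge y\rangle-(-1)^{|\xi||\eta|}\langle\mathfrak{ad}_{\alpha_{\mathfrak{g}}^*(\eta)}(\Delta^*(\xi)),\alpha_{\mathfrak{g}}(x)\wedge y\rangle$. A Manin supertriple of Hom-Lie superalgebras is a triple of Hom-Lie superalgebras $(\mathfrak{M},\mathfrak{g},\mathfrak{g}')$ with a nondegenerate supersymmetric bilinear form $S$ on $\mathfrak{M}$ (i.e. $S(v,w)=(-1)^{|v||w|}S(w,v)$) such that (1) $S$ is invariant: $S([x,y]_{\mathfrak{M}},z)=S(x,[y,z]_{\mathfrak{M}})$ and $S(\phi_{\mathfrak{M}}(x),y)=S(x,\phi_{\mathfrak{M}}(y))$, where $\phi_{\mathfrak{M}}$ is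 the twisting map of $\mathfrak{M}$; (2) $\mathfrak{g}$ and $\mathfrak{g}'$ are isotropic Hom-Lie sub-superalgebras of $\mathfrak{M}$ (so $\phi_{\mathfrak{M}}$ restricts to their twisting maps) with $\mathfrak{M}=\mathfrak{g}\oplus\mathfrak{g}'$ as superspaces. *)

(* Defs.v *)
From HB Require Import structures.
From mathcomp Require Import all_boot all_order all_algebra.

Set Implicit Arguments.
Unset Strict Implicit.
Unset Printing Implicit Defensive.

Import GRing.Theory.
Local Open Scope ring_scope.

Section Linear.
Variable K : fieldType.

Definition bilin (U V W : lmodType K) (f : U -> V -> W) : Prop :=
  (forall v, linear (f^~ v)) /\ (forall u, linear (f u)).

Lemma linE (U V : lmodType K) (f : U -> V) (fL : linear f) :
  exists g : {linear U -> V}, f = g.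
Proof.
pose m := GRing.isLinear.Build K U V *:%R f fL.
by pose g : {linear U -> V} := HB.pack f m; exists g.
Qed.

Lemma linfunE (U V : vectType K) (f : U -> V) (fL : linear f) u :
  linfun f u = f u.
Proof. by have [g ->] := linE fL; rewrite lfunE. Qed.

Section Lin.
Variables (U V : lmodType K) (f : U -> V) (fL : linear f).
Lemma lin_sum (I : Type) (r : seq I) (P : pred I) F :
  f (\sum_(i <- r | P i) F i) = \sum_(i <- r | P i) f (F i).
Proof. by have [g ->] := linE fL; rewrite linear_sum. Qed.
Lemma linZ a u : f (a *: u) = a *: f u.
Proof. by have [g ->] := linE fL; rewrite linearZ. Qed.
Lemma linD u v : f (u + v) = f u + f v.
Proof. by have [g ->] := linE fL; rewrite linearD. Qed.
Lemma linN u : f (- u) = - f u.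
Proof. by have [g ->] := linE fL; rewrite linearN. Qed.
Lemma lin0 : f 0 = 0.
Proof. by have [g ->] := linE fL; rewrite linear0. Qed.
End Lin.

Lemma sum_linear (U V : lmodType K) (I : Type) (r : seq I) (P : pred I)
    (f : I -> U -> V) :
  (forall i, linear (f i)) -> linear (fun u => \sum_(i <- r | P i) f i u).
Proof.
move=> fL a u v; rewrite scaler_sumr -big_split /=.
by apply: eq_bigr => i _; rewrite fL.
Qed.

Lemma scale_linear (U V : lmodType K) (c : K) (f : U -> V) :
  linear f -> linear (fun u => c *: f u).
Proof. by move=> fL a u v; rewrite fL scalerDr !scalerA mulrC. Qed.

Lemma opp_linear (U V : lmodType K) (f : U -> V) :
  linear f -> linear (fun u => - f u).
Proof. by move=> fL a u v; rewrite fL opprD scalerN. Qed.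

Lemma add_linear (U V : lmodType K) (f g : U -> V) :
  linear f -> linear g -> linear (fun u => f u + g u).
Proof. by move=> fL gL a u v; rewrite fL gL scalerDr addrACA. Qed.

Lemma comp_linear (U V W : lmodType K) (f : V -> W) (g : U -> V) :
  linear f -> linear g -> linear (fun u => f (g u)).
Proof. by move=> fL gL a u v; rewrite gL fL. Qed.

Lemma lfun_linear (U V : vectType K) (f : 'Hom(U, V)) : linear f.
Proof. by move=> a u v; rewrite linearP. Qed.

End Linear.

Record superspace (K : fieldType) := Superspace {
  carrier :> vectType K;
  part : bool -> {vspace carrier};
  part_full : (part false + part true)%VS = fullv;
  part_direct : (part false :&: part true)%VS = 0%VS
}.

Section Superspaces.
Variable K : fieldType.
Implicit Types U V W Z : superspace K.

(* hc V i is the projection on the component of parity i *)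
Definition hc V (i : bool) : 'End(V) := daddv_pi (part V i) (part V (~~ i)).

Lemma hc_in V i x : hc V i x \in part V i.
Proof. exact: memv_pi. Qed.

Lemma part_directN V i : (part V i :&: part V (~~ i))%VS = 0%VS.
Proof. by case: i; rewrite /= ?[(part V true :&: _)%VS]capvC part_direct. Qed.

Lemma hc_id V i x : x \in part V i -> hc V i x = x.
Proof. by apply: daddv_pi_id; exact: part_directN. Qed.

Lemma sum_hc V x : \sum_(i : bool) hc V i x = x.
Proof.
rewrite big_bool /= addrC daddv_pi_add //; first exact: part_direct.
by rewrite part_full memvf.
Qed.

Lemma hc_neq V i j x : x \in part V i -> j != i -> hc V j x = 0.
Proof.
move=> xi ji; have -> : j = ~~ i by case: i j ji {xi} => -[].
apply: (addrI (hc V i x)); rewrite addr0 [X in _ = X](hc_id xi) -[RHS]sum_hc.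
by rewrite big_bool; case: (i) => //=; rewrite addrC.
Qed.

Lemma hcE V i j x : x \in part V i -> hc V j x = if j == i then x else 0.
Proof. by move=> xi; case: eqP => [->|/eqP]; [exact: hc_id|exact: hc_neq]. Qed.

Lemma sum_hcE V (Z : lmodType K) i x (f : bool -> V -> Z) :
  x \in part V i -> (forall j, f j 0 = 0) -> \sum_j f j (hc V j x) = f i x.
Proof.
move=> xi f0; rewrite (bigD1 i) //= big1 ?addr0 ?hc_id // => j ji.
by rewrite (hc_neq xi ji).
Qed.

Lemma hom_lin_eq V (Z : lmodType K) (f g : V -> Z) : linear f -> linear g ->
  (forall i x, x \in part V i -> f x = g x) -> f =1 g.
Proof.
move=> fL gL fg x; rewrite -(sum_hc x) (lin_sum fL) (lin_sum gL).
by apply: eq_bigr => i _; apply: (fg i); exact: hc_in.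
Qed.

Definition even_map V W (f : V -> W) : Prop :=
  forall i x, x \in part V i -> f x \in part W i.

Definition even_bilin U V W (f : U -> V -> W) : Prop :=
  forall i j x y, x \in part U i -> y \in part V j ->
    f x y \in part W (i (+) j).

(* The bilinear map sending homogeneous (x, y) to (-1)^(|x||y|) f x y:
   this is how formulas given on homogeneous elements are extended below. *)
Definition koszul U V (Z : lmodType K) (f : U -> V -> Z) (x : U) (y : V) : Z :=
  \sum_(i : bool) \sum_(j : bool) (-1) ^+ (i && j) *: f (hc U i x) (hc V j y).

Lemma koszul_hom U V (Z : lmodType K) (f : U -> V -> Z) i j x y :
  bilin f -> x \in part U i -> y \in part V j ->
  koszul f x y = (-1) ^+ (i && j) *: f x y.
Proof.
move=> [fl fr] xi yj; rewrite /koszul.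
rewrite (sum_hcE (f := fun i x => \sum_j (-1) ^+ (i && j) *: f x (hc V j y)) xi).
  by rewrite (sum_hcE (f := fun j y => (-1) ^+ (i && j) *: f x y) yj) // => k;
     rewrite (lin0 (fr x)) scaler0.
by move=> k; rewrite big1 // => l _; rewrite (lin0 (fl _)) scaler0.
Qed.

Lemma koszul_bilin U V (Z : lmodType K) (f : U -> V -> Z) :
  bilin f -> bilin (koszul f).
Proof.
move=> [fl fr]; split=> z; do 2![apply: sum_linear => ?];
  apply: scale_linear.
- by apply: (comp_linear (f := f^~ _)); [exact: fl | exact: lfun_linear].
- by apply: (comp_linear (f := f _)); [exact: fr | exact: lfun_linear].
Qed.

(* [repr B F] is the vector u such that B u w = F w for all w. *)
Definition repr (U W : vectType K) (B : U -> W -> K^o) (F : W -> K^o) : U :=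
  ((linfun (fun u => linfun (B u)))^-1)%VF (linfun F).

Definition perfect (U W : vectType K) (B : U -> W -> K^o) : Prop :=
  [/\ bilin B, forall u, (forall w, B u w = 0) -> u = 0
    & forall F : W -> K^o, linear F -> exists u, forall w, B u w = F w].

Lemma linfun2E (U W Z : vectType K) (B : U -> W -> Z) u w : bilin B ->
  linfun (fun u => linfun (B u)) u w = B u w.
Proof.
move=> [Bl Br]; rewrite linfunE ?linfunE // => a v v'.
by apply/lfunP => z; rewrite add_lfunE scale_lfunE !linfunE //; exact: Bl.
Qed.

Lemma reprE (U W : vectType K) (B : U -> W -> K^o) F : perfect B -> linear F ->
  forall w, B (repr B F) w = F w.
Proof.
move=> [Bb _ Bs] FL w; rewrite -(linfun2E _ _ Bb) /repr.
rewrite limg_lfunVK ?linfunE //.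
have [u uF] := Bs F FL; apply/memv_imgP; exists u; first exact: memvf.
by apply/lfunP => v; rewrite linfun2E // linfunE.
Qed.

Lemma repr_uniq (U W : vectType K) (B : U -> W -> K^o) F u :
  perfect B -> (forall w, B u w = F w) -> u = repr B F.
Proof.
move=> Bp uF; have [[Bl Br] Bi _] := Bp.
have FL : linear F by move=> a v w; rewrite -!uF Br.
have D := linD (Bl _); have N := linN (Bl _).
apply/eqP; rewrite -subr_eq0; apply/eqP/Bi => w.
by rewrite D N uF (reprE Bp FL) subrr.
Qed.

Lemma repr_linear (U V W : vectType K) (B : U -> W -> K^o) (F : V -> W -> K^o) :
  perfect B -> bilin F -> linear (fun v => repr B (F v)).
Proof.
move=> Bp [Fl Fr] a u v; have [[Bl Br] Bi _] := Bp.
apply/esym/(repr_uniq Bp) => w; rewrite Bl !(reprE Bp) //.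
by rewrite Fl.
Qed.

(* linear forms of parity i: those vanishing on the component of parity 1 - i *)
Definition dual_part V (i : bool) : {vspace 'Hom(V, K^o)} :=
  lker (linfun (fun xi : 'Hom(V, K^o) => (xi \o hc V (~~ i))%VF)).

Lemma dual_partP V i (xi : 'Hom(V, K^o)) :
  reflect (forall x, x \in part V (~~ i) -> xi x = 0) (xi \in dual_part V i).
Proof.
have L : linear (fun xi : 'Hom(V, K^o) => (xi \o hc V (~~ i))%VF).
  by move=> a u v; rewrite comp_lfunDl comp_lfunZl.
rewrite memv_ker (linfunE L); apply: (iffP eqP) => [E x xi'|E].
  by move/lfunP/(_ x): E; rewrite comp_lfunE zero_lfunE hc_id.
by apply/lfunP => x; rewrite comp_lfunE zero_lfunE E // hc_in.
Qed.

Lemma dual_part_comp V i (xi : 'Hom(V, K^o)) :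
  (xi \o hc V i)%VF \in dual_part V i.
Proof.
apply/dual_partP => x xN; rewrite comp_lfunE (hc_neq xN) ?linear0 //.
by case: (i).
Qed.

Lemma dual_full V : (dual_part V false + dual_part V true)%VS = fullv.
Proof.
apply/vspaceP => xi; rewrite memvf; apply/memv_addP.
exists (xi \o hc V false)%VF; first exact: dual_part_comp.
exists (xi \o hc V true)%VF; first exact: dual_part_comp.
rewrite -comp_lfunDr; apply/lfunP => x; rewrite comp_lfunE add_lfunE.
by rewrite addrC -{1}(sum_hc x) big_bool.
Qed.

Lemma dual_direct V : (dual_part V false :&: dual_part V true)%VS = 0%VS.
Proof.
apply/vspaceP => xi; rewrite memv0 memv_cap; apply/andP/eqP => [[E0 E1]|->].
  apply/lfunP => x; rewrite zero_lfunE -(sum_hc x) big_bool linearD /=.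
  rewrite (elimT (dual_partP _ _) E0) ?hc_in //.
  by rewrite (elimT (dual_partP _ _) E1) ?hc_in ?addr0.
by rewrite !mem0v.
Qed.

Definition dual V : superspace K := Superspace (dual_full V) (dual_direct V).

(* <xi, x> *)
Definition pairDV V (xi : dual V) (x : V) : K^o := (xi : 'Hom(V, K^o)) x.
(* <x, xi> *)
Definition pairVD V (x : V) (xi : dual V) : K^o :=
  koszul (fun x xi => pairDV xi x) x xi.

Definition dual_map V (a : 'End(V)) : 'End(dual V) :=
  linfun (fun xi : dual V => ((xi : 'Hom(V, K^o)) \o a)%VF : dual V).

Definition even_form V W (B : V -> W -> K^o) : Prop :=
  forall i j x y, x \in part V i -> y \in part W j -> i != j -> B x y = 0.

Lemma dual_mapE V (a : 'End(V)) xi x :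
  pairDV (dual_map a xi) x = pairDV xi (a x).
Proof.
rewrite /pairDV /dual_map linfunE ?comp_lfunE // => c u v.
exact: (etrans (comp_lfunDl _ _ _) (congr1 (+%R^~ _) (esym (comp_lfunZl _ _ _)))).
Qed.

Lemma pairDV_bilin V : bilin (@pairDV V).
Proof.
split=> [x a u v|xi]; last exact: lfun_linear.
by rewrite /pairDV add_lfunE scale_lfunE.
Qed.

Lemma pairDV_even V : even_form (@pairDV V).
Proof.
move=> i j xi x /dual_partP xi0 xj ij; apply: xi0.
by case: i j ij xj => -[].
Qed.

Lemma pairVD_bilin V : bilin (@pairVD V).
Proof. by apply: koszul_bilin; case: (pairDV_bilin V). Qed.

Lemma pairVDE V i j x xi : x \in part V i -> xi \in part (dual V) j ->
  pairVD x xi = (-1) ^+ (i && j) *: pairDV xi x.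
Proof.
by move=> xi' xj; apply: koszul_hom => //; case: (pairDV_bilin V).
Qed.

Lemma pairVD_hom V (i : bool) x xi : x \in part V i ->
  pairVD x xi = (-1) ^+ i *: pairDV xi x.
Proof.
move=> xi'; have [L _] := pairDV_bilin V; have [_ L'] := pairVD_bilin V.
apply: (hom_lin_eq (V := dual V) (f := pairVD x)
  (g := fun xi => (-1) ^+ i *: pairDV xi x)) => [||j zeta zj].
- exact: L'.
- exact/scale_linear/L.
rewrite (pairVDE xi' zj).
have [->|ji] := eqVneq j i; first by rewrite andbb.
by rewrite (pairDV_even zj xi' ji) !scaler0.
Qed.

Lemma pairVD_even V : even_form (@pairVD V).
Proof.
move=> i j x xi xi' xj ij; rewrite (pairVD_hom _ xi').
by rewrite (pairDV_even xj xi') ?scaler0 // eq_sym.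
Qed.

Definition dbasis V (i : 'I_(\dim {:V})) : dual V :=
  linfun (coord (vbasis {:V}) i : V -> K^o).
Definition ebasis V (i : 'I_(\dim {:V})) : V := (vbasis {:V})`_i.

Lemma dbasisE V (i : 'I_(\dim {:V})) (x : V) : pairDV (dbasis i) x = coord (vbasis {:V}) i x.
Proof. by rewrite /pairDV /dbasis linfunE // => a u v; rewrite linearP. Qed.

Lemma ebasis_sum V (x : V) : \sum_i pairDV (dbasis i) x *: ebasis i = x.
Proof.
rewrite [RHS](coord_vbasis (memvf x)).
by apply: eq_bigr => i _; rewrite dbasisE.
Qed.

Lemma pairDV_perfect V : perfect (@pairDV V).
Proof.
split=> [|xi E|F FL]; first exact: pairDV_bilin.
  by apply/lfunP => x; rewrite [LHS]E zero_lfunE.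
by exists (linfun F : dual V) => w; rewrite /pairDV linfunE.
Qed.

Lemma pairDV_opp_perfect V : perfect (fun x xi => @pairDV V xi x).
Proof.
have [L R] := pairDV_bilin V.
split=> [|x E|F FL]; first by split.
  by rewrite -(ebasis_sum x) big1 // => i _; rewrite E scale0r.
exists (\sum_i F (dbasis i) *: ebasis i) => xi.
rewrite (lin_sum (R xi)).
transitivity (F (\sum_i pairDV xi (ebasis i) *: dbasis i)).
  rewrite (lin_sum FL); apply: eq_bigr => i _.
  by rewrite (linZ (R _)) (linZ FL); exact: mulrC.
congr F; apply/lfunP => x; rewrite sum_lfunE -[RHS]/(pairDV xi x).
rewrite -[in RHS](ebasis_sum x) (lin_sum (R _)); apply: eq_bigr => i _.
by rewrite scale_lfunE (linZ (R _)) -/(pairDV _ x); exact: mulrC.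
Qed.

Lemma parity_iso V : exists s : 'End(V), involutive s /\
  forall (i : bool) x, x \in part V i -> s x = (-1) ^+ i *: x.
Proof.
pose s := fun x => \sum_(i : bool) (-1) ^+ i *: hc V i x.
have sL : linear s.
  by apply: sum_linear => i; apply: scale_linear; exact: lfun_linear.
have sE (i : bool) x : x \in part V i -> s x = (-1) ^+ i *: x.
  move=> xi; rewrite /s (sum_hcE (f := fun (i : bool) x => (-1) ^+ i *: x) xi) //.
  by move=> j; rewrite scaler0.
exists (linfun s); split=> [x|i x xi]; rewrite !(linfunE sL); last exact: sE.
move: x; apply: (hom_lin_eq (V := V)) => // [|i x xi].
  exact: (comp_linear (f := s)).
by rewrite (sE i x xi) (linZ sL) (sE i x xi) scalerA -expr2 sqrr_sign scale1r.
Qed.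

Lemma pairVD_perfect V : perfect (@pairVD V).
Proof.
have [s [ss sE]] := parity_iso V; have [L R] := pairDV_bilin V.
have [_ Pi Ps] := pairDV_opp_perfect V.
have VDs x xi : pairVD x xi = pairDV xi (s x).
  move: x; apply: (hom_lin_eq (V := V)); first exact: (pairVD_bilin V).1.
    exact: (comp_linear (f := pairDV xi)) (R xi) (lfun_linear s).
  by move=> i x xi'; rewrite (sE i) // (pairVD_hom _ xi') (linZ (R _)).
split=> [|x E|F FL]; first exact: pairVD_bilin.
  rewrite -[x]ss [s x]Pi ?linear0 // => xi; by rewrite -VDs E.
by have [u uF] := Ps F FL; exists (s u) => w; rewrite VDs ss uF.
Qed.

Lemma pairVD_opp_perfect V : perfect (fun xi x => @pairVD V x xi).
Proof.
have [s [ss sE]] := parity_iso V; have [L R] := pairDV_bilin V.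
have [_ Pi Ps] := pairDV_perfect V.
have VDs x xi : pairVD x xi = pairDV xi (s x).
  move: x; apply: (hom_lin_eq (V := V)); first exact: (pairVD_bilin V).1.
    exact: (comp_linear (f := pairDV xi)) (R xi) (lfun_linear s).
  by move=> i x xi'; rewrite (sE i) // (pairVD_hom _ xi') (linZ (R _)).
split=> [|xi E|F FL]; first by case: (pairVD_bilin V).
  by apply: Pi => x; rewrite -[x]ss -VDs E.
have FsL : linear (fun x => F (s x)).
  exact: (comp_linear (f := F)) FL (lfun_linear s).
by have [u uF] := Ps _ FsL; exists u => w; rewrite VDs uF ss.
Qed.

End Superspaces.

Section ExteriorSquare.
Variable K : fieldType.
Implicit Types U V W : superspace K.

Definition super_skew V (Z : lmodType K) (f : V -> V -> Z) : Prop :=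
  forall i j x y, x \in part V i -> y \in part V j ->
    f x y = - ((-1) ^+ (i && j) *: f y x).

(* On homogeneous elements, f x y - (-1)^(|x||y|) f y x. *)
Definition skewize V (Z : lmodType K) (f : V -> V -> Z) (x y : V) : Z :=
  f x y - koszul (fun x y => f y x) x y.

Lemma skewize_bilin V (Z : lmodType K) (f : V -> V -> Z) :
  bilin f -> bilin (skewize f).
Proof.
move=> [fl fr]; have [kl kr] : bilin (koszul (fun x y => f y x)).
  exact: koszul_bilin.
by split=> z; apply: add_linear => //; exact: opp_linear.
Qed.

Lemma skewize_hom V (Z : lmodType K) (f : V -> V -> Z) i j x y : bilin f ->
  x \in part V i -> y \in part V j ->
  skewize f x y = f x y - (-1) ^+ (i && j) *: f y x.
Proof.
move=> [fl fr] xi yj; rewrite /skewize (koszul_hom (i := i) (j := j)) //.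
Qed.

Lemma skewize_skew V (Z : lmodType K) (f : V -> V -> Z) :
  bilin f -> super_skew (skewize f).
Proof.
move=> fb i j x y xi yj; rewrite (skewize_hom fb xi yj) (skewize_hom fb yj xi).
by rewrite [j && i]andbC scalerBr signrZK opprB.
Qed.

(* V (x) V, realized as Hom(V^*, V): x (x) y is xi |-> <xi, x> y. *)
Definition tens2 V : vectType K := 'Hom(dual V, V).

Definition tens V (x y : V) : tens2 V :=
  linfun (fun xi : dual V => (pairDV xi x : K) *: y).

(* The linear map induced by a bilinear map f, sending x (x) y to f x y. *)
Definition tens_lift V (Z : lmodType K) (f : V -> V -> Z) (T : tens2 V) : Z :=
  \sum_i f (ebasis i) ((T : 'Hom(dual V, V)) (dbasis i)).

Lemma rscale_linear (U Z : lmodType K) (f : U -> K^o) (z : Z) :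
  linear f -> linear (fun u => (f u : K) *: z).
Proof. by move=> fL a u v; rewrite fL scalerDl scalerA. Qed.

Lemma tensE V (x y : V) xi :
  (tens x y : 'Hom(dual V, V)) xi = (pairDV xi x : K) *: y.
Proof.
by rewrite /tens linfunE //; apply: rscale_linear; case: (pairDV_bilin V).
Qed.

Lemma tens_bilin V : bilin (@tens V).
Proof.
have [L R] := pairDV_bilin V.
split=> [y a u v|x a u v]; apply/lfunP => xi;
  rewrite add_lfunE scale_lfunE !tensE.
  by rewrite R scalerDl scalerA.
by rewrite scalerDr !scalerA mulrC.
Qed.

Lemma tens_lift_linear V (Z : lmodType K) (f : V -> V -> Z) :
  bilin f -> linear (tens_lift f).
Proof.
move=> [_ fr]; apply: sum_linear => i; apply: (comp_linear (f := f _)) => //.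
by move=> a u v; rewrite add_lfunE scale_lfunE.
Qed.

Lemma tens_liftE V (Z : lmodType K) (f : V -> V -> Z) x y :
  bilin f -> tens_lift f (tens x y) = f x y.
Proof.
move=> [fl fr]; rewrite -[in RHS](ebasis_sum x) (lin_sum (fl y)).
by apply: eq_bigr => i _; rewrite tensE (linZ (fr _)) (linZ (fl y)).
Qed.

Lemma tens_sum V (T : tens2 V) :
  T = \sum_i tens (ebasis i) ((T : 'Hom(dual V, V)) (dbasis i)).
Proof.
apply/lfunP => xi; rewrite sum_lfunE.
have {1}-> : xi = \sum_i (pairDV xi (ebasis i) : K) *: dbasis i.
  apply/lfunP => x; rewrite sum_lfunE -[LHS]/(pairDV xi x).
  have [L R] := pairDV_bilin V.
  rewrite -[in LHS](ebasis_sum x) (lin_sum (R _)); apply: eq_bigr => i _.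
  by rewrite scale_lfunE (linZ (R _)) -/(pairDV _ x); exact: mulrC.
by rewrite linear_sum; apply: eq_bigr => i _; rewrite linearZ tensE.
Qed.

Lemma tens_eq V (Z : lmodType K) (f g : tens2 V -> Z) : linear f -> linear g ->
  (forall i j x y, x \in part V i -> y \in part V j ->
     f (tens x y) = g (tens x y)) -> f =1 g.
Proof.
move=> fL gL fg T; rewrite (tens_sum T) (lin_sum fL) (lin_sum gL).
apply: eq_bigr => i _; have [tl tr] := tens_bilin V.
move: (ebasis i) (_ (dbasis i)) => x y; move: x.
apply: (hom_lin_eq (V := V)) => [||a x xa].
- exact: (comp_linear (f := f)).
- exact: (comp_linear (f := g)).
move: y; apply: (hom_lin_eq (V := V)) => [||b y yb]; last exact: fg xa yb.
- exact: (comp_linear (f := f)).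
- exact: (comp_linear (f := g)).
Qed.

(* The component of parity p of a tensor *)
Definition tens_hc V (p : bool) (T : tens2 V) : tens2 V :=
  \sum_(i : bool) (hc V (i (+) p) \o ((T : 'Hom(dual V, V)) \o hc (dual V) i))%VF.

Lemma tens_hc_linear V p : linear (@tens_hc V p).
Proof.
apply: sum_linear => i a u v.
by rewrite comp_lfunDl comp_lfunDr comp_lfunZr -comp_lfunZl.
Qed.

Lemma tens_hcE V i j p (x y : V) : x \in part V i -> y \in part V j ->
  tens_hc p (tens x y) = if p == i (+) j then tens x y else 0.
Proof.
move=> xi yj; have [L R] := pairDV_bilin V.
apply/lfunP => xi0; rewrite sum_lfunE.
have E b : pairDV (hc (dual V) b xi0) x = if b == i then pairDV xi0 x else 0.
  case: eqVneq => [->|bi].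
    rewrite -[in RHS](sum_hc xi0) (lin_sum (L x)) (bigD1 i) //= big1 ?addr0 //.
    by move=> k ki; rewrite (pairDV_even (hc_in _ _) xi).
  by rewrite (pairDV_even (hc_in _ _) xi).
rewrite (bigD1 i) //= big1 => [|b bi]; rewrite !comp_lfunE tensE linearZ /= E.
  rewrite eqxx addr0 (hcE _ yj).
  have -> : (i (+) p == j) = (p == i (+) j).
    by case: (i); case: (p); case: (j).
  by case: ifP; rewrite ?scaler0 ?zero_lfunE ?tensE.
by rewrite (negbTE bi) scale0r.
Qed.

Definition tens_part V (p : bool) : {vspace tens2 V} :=
  lker (linfun (@tens_hc V (~~ p))).

Lemma tens_partP V p (T : tens2 V) : (T \in tens_part V p) = (tens_hc (~~ p) T == 0).
Proof. by rewrite memv_ker (linfunE (@tens_hc_linear V _)). Qed.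

Definition alt_map V : 'End(tens2 V) := linfun (tens_lift (skewize (@tens V))).

Lemma alt_mapE V (x y : V) : alt_map V (tens x y) = skewize (@tens V) x y.
Proof.
have tb := skewize_bilin (tens_bilin V).
by rewrite linfunE ?tens_liftE //; exact: tens_lift_linear.
Qed.

Lemma alt_hc V p (T : tens2 V) : tens_hc p (alt_map V T) = alt_map V (tens_hc p T).
Proof.
have HL := @tens_hc_linear V p; have AL := lfun_linear (alt_map V).
move: T; apply: tens_eq => [||i j x y xi yj].
- exact: (comp_linear HL AL).
- exact: (comp_linear AL HL).
rewrite (tens_hcE _ xi yj) alt_mapE (skewize_hom (tens_bilin V) xi yj).
rewrite (linD HL) (linN HL) (linZ HL) (tens_hcE _ xi yj) (tens_hcE _ yj xi).
rewrite [j (+) i]addbC; case: ifP => _.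
  by rewrite alt_mapE (skewize_hom (tens_bilin V) xi yj).
by rewrite scaler0 subr0 (lin0 (lfun_linear _)).
Qed.

(* \wedge^2 V, as the space of tensors spanned by the
   x (x) y - (-1)^(|x||y|) y (x) x *)
Definition ext2_space V : {vspace tens2 V} := limg (alt_map V).

Definition ext2_part V (p : bool) : {vspace subvs_of (ext2_space V)} :=
  (linfun vsval @^-1: tens_part V p)%VS.

Lemma ext2_partP V p (P : subvs_of (ext2_space V)) :
  (P \in ext2_part V p) = (tens_hc (~~ p) (vsval P) == 0).
Proof. by rewrite -memv_preim lfunE tens_partP. Qed.

Lemma tens_hcK V p q (T : tens2 V) :
  tens_hc p (tens_hc q T) = if p == q then tens_hc q T else 0.
Proof.
have HL q := @tens_hc_linear V q.
pose g (T : tens2 V) : tens2 V := if p == q then tens_hc q T else 0.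
have gL : linear g.
  by rewrite /g; case: eqP => // _ a u v; rewrite scaler0 addr0.
rewrite -/(g T); move: T; apply: tens_eq => // [|i j x y xi yj].
  exact: (comp_linear (HL p) (HL q)).
rewrite /g (tens_hcE _ xi yj); case: eqVneq => [qij|_].
  by rewrite (tens_hcE _ xi yj) -qij.
by rewrite (lin0 (HL p)) if_same.
Qed.

Lemma tens_hc_sum V (T : tens2 V) : tens_hc false T + tens_hc true T = T.
Proof.
have HL q := @tens_hc_linear V q.
move: T; apply: (tens_eq (g := id)) => // [|i j x y xi yj].
  exact: add_linear.
rewrite !(tens_hcE _ xi yj).
by case: (i (+) j); rewrite ?add0r ?addr0.
Qed.

Lemma ext2_hc_in V p (P : subvs_of (ext2_space V)) :
  tens_hc p (vsval P) \in ext2_space V.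
Proof.
have /memv_imgP [T _ ->] := subvsP P.
by rewrite alt_hc; exact/memv_img/memvf.
Qed.

Lemma ext2_full V : (ext2_part V false + ext2_part V true)%VS = fullv.
Proof.
apply/vspaceP => P; rewrite memvf; apply/memv_addP.
pose Q p := vsproj (ext2_space V) (tens_hc p (vsval P)).
have Qp p : Q p \in ext2_part V p.
  rewrite ext2_partP vsprojK ?ext2_hc_in // tens_hcK.
  by case: (p).
exists (Q false) => //; exists (Q true) => //.
by rewrite -[LHS]vsvalK -[X in vsproj _ X]tens_hc_sum linearD.
Qed.

Lemma ext2_direct V : (ext2_part V false :&: ext2_part V true)%VS = 0%VS.
Proof.
apply/vspaceP => P; rewrite memv0 memv_cap; apply/andP/eqP => [[]|->].
  rewrite !ext2_partP => /eqP E1 /eqP E0.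
  by rewrite -[P]vsvalK -[X in vsproj _ X]tens_hc_sum E0 E1 addr0 linear0.
by rewrite !mem0v.
Qed.

Definition ext2 V : superspace K := Superspace (ext2_full V) (ext2_direct V).

Definition wedge V (x y : V) : ext2 V :=
  vsproj (ext2_space V) (skewize (@tens V) x y).

(* The linear map on \wedge^2 V sending x /\ y to f x y, for f a super-skew
   bilinear map; the factor 1/2 is there because the map induced by f on V (x) V
   sends the tensor x /\ y to 2 f x y *)
Definition ext2_lift V (Z : lmodType K) (f : V -> V -> Z) (P : ext2 V) : Z :=
  (2%:R : K)^-1 *: tens_lift f (vsval (P : subvs_of (ext2_space V))).

Lemma wedge_bilin V : bilin (@wedge V).
Proof.
have [L R] := skewize_bilin (tens_bilin V).
by split=> z a u v; rewrite /wedge ?L ?R linearP.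
Qed.

Lemma wedge_skew V : super_skew (@wedge V).
Proof.
move=> i j x y xi yj; rewrite /wedge.
by rewrite (skewize_skew (tens_bilin V) xi yj) linearN linearZ.
Qed.

Lemma vsval_wedge V (x y : V) :
  vsval (wedge x y : subvs_of (ext2_space V)) = skewize (@tens V) x y.
Proof. by rewrite vsprojK // -alt_mapE; exact/memv_img/memvf. Qed.

Lemma wedge_even V : even_bilin (@wedge V).
Proof.
move=> i j x y xi yj; rewrite ext2_partP vsval_wedge.
rewrite (skewize_hom (tens_bilin V) xi yj).
have HL := @tens_hc_linear V (~~ (i (+) j)).
rewrite (linD HL) (linN HL) (linZ HL) (tens_hcE _ xi yj) (tens_hcE _ yj xi).
by rewrite [j (+) i]addbC; case: (i (+) j); rewrite /= scaler0 subr0.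
Qed.

Lemma ext2_eq V (Z : lmodType K) (f g : ext2 V -> Z) : linear f -> linear g ->
  (forall i j x y, x \in part V i -> y \in part V j ->
     f (wedge x y) = g (wedge x y)) -> f =1 g.
Proof.
move=> fL gL fg P; have /memv_imgP [T _ E] := subvsP (P : subvs_of (ext2_space V)).
have -> : P = vsproj (ext2_space V) (alt_map V T) by rewrite -E vsvalK.
have pL : linear (fun T => vsproj (ext2_space V) (alt_map V T)).
  by move=> a u v; rewrite !linearP.
move: T {E}; apply: tens_eq => [||i j x y xi yj].
- exact: (comp_linear fL pL).
- exact: (comp_linear gL pL).
by rewrite alt_mapE; exact: fg xi yj.
Qed.

Lemma ext2_lift_linear V (Z : lmodType K) (f : V -> V -> Z) :
  bilin f -> linear (ext2_lift f).
Proof.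
move=> fb; apply: scale_linear; apply: (comp_linear (tens_lift_linear fb)).
by move=> a u v; rewrite linearP.
Qed.

Lemma ext2_liftE V (Z : lmodType K) (f : V -> V -> Z) x y :
  2%:R != 0 :> K -> bilin f -> super_skew f -> ext2_lift f (wedge x y) = f x y.
Proof.
move=> K2 fb fs; have [wl wr] := wedge_bilin V; have [fl fr] := fb.
have lL := ext2_lift_linear fb.
move: x; apply: (hom_lin_eq (V := V)) => // [|i x xi].
  exact: (comp_linear lL).
move: y; apply: (hom_lin_eq (V := V)) => // [|j y yj].
  exact: (comp_linear lL).
have tL := tens_lift_linear fb.
rewrite /ext2_lift vsval_wedge (skewize_hom (tens_bilin V) xi yj).
rewrite (linD tL) (linN tL) (linZ tL) !tens_liftE // (fs j i y x) //.
rewrite [j && i]andbC scalerN signrZK opprK -mulr2n -scaler_nat.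
by rewrite scalerA mulVf // scale1r.
Qed.

End ExteriorSquare.

Section ExteriorPairing.
Variable K : fieldType.
Implicit Types U V W : superspace K.

(* On homogeneous elements,
     (-1)^(|y||xi|) B x xi * B y eta
       - (-1)^(|x||y| + |x||xi|) B y xi * B x eta. *)
Definition pairT U W (B : U -> W -> K^o) (x y : U) (xi eta : W) : K^o :=
  skewize (fun x y => koszul (fun y xi => (B x xi : K) *: B y eta) y xi) x y.

(* The pairing of \wedge^2 U and \wedge^2 W induced by a pairing B of U and W *)
Definition pair2 U W (B : U -> W -> K^o) (P : ext2 U) (Q : ext2 W) : K^o :=
  ext2_lift (fun x y => ext2_lift (pairT B x y) Q) P.

Lemma scalerC (Z : lmodType K) (a b : K) (z : Z) : a *: (b *: z) = b *: (a *: z).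
Proof. by rewrite !scalerA mulrC. Qed.

Lemma rscaleC (a b : K^o) : (a : K) *: b = (b : K) *: a.
Proof. exact: mulrC. Qed.

Lemma koszul_param (E Z : lmodType K) U V (f : E -> U -> V -> Z) x y :
  (forall x y, linear (fun e => f e x y)) -> linear (fun e => koszul (f e) x y).
Proof.
by move=> fL; do 2![apply: sum_linear => ?]; apply: scale_linear.
Qed.

Lemma skewize_param (E Z : lmodType K) V (f : E -> V -> V -> Z) x y :
  (forall x y, linear (fun e => f e x y)) -> linear (fun e => skewize (f e) x y).
Proof.
move=> fL; apply: add_linear => //; apply: opp_linear.
exact: (koszul_param (f := fun e x y => f e y x)).
Qed.

Lemma ext2_lift_param (E Z : lmodType K) V (f : E -> V -> V -> Z) P :
  (forall x y, linear (fun e => f e x y)) -> linear (fun e => ext2_lift (f e) P).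
Proof.
by move=> fL; apply: scale_linear; apply: sum_linear => i.
Qed.

Section Pair.
Variables (U W : superspace K) (B : U -> W -> K^o).
Hypothesis Bb : bilin B.

Let hb xi eta :
  bilin (fun x y => koszul (fun y xi => (B x xi : K) *: B y eta) y xi).
Proof.
have [Bl Br] := Bb; split=> z.
  by apply: koszul_param => y zeta; apply: rscale_linear.
suff /koszul_bilin[] : bilin (fun y xi => (B z xi : K) *: B y eta) by [].
by split=> t; [apply: scale_linear | apply: rscale_linear].
Qed.

Lemma pairT_bilin xi eta : bilin (fun x y => pairT B x y xi eta).
Proof. exact: skewize_bilin (hb xi eta). Qed.

Lemma pairT_skew xi eta : super_skew (fun x y => pairT B x y xi eta).
Proof. exact: skewize_skew (hb xi eta). Qed.

Lemma pairT_bilin2 x y : bilin (pairT B x y).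
Proof.
have [Bl Br] := Bb; split=> z; apply: skewize_param => {}x {}y.
  suff /koszul_bilin[] : bilin (fun y xi => (B x xi : K) *: B y z) by [].
  by split=> t; [apply: scale_linear | apply: rscale_linear].
by apply: koszul_param => t zeta; apply: scale_linear.
Qed.

Hypothesis Be : even_form B.

Lemma pairT_hom a b x y xi eta : xi \in part W a -> eta \in part W b ->
  pairT B x y xi eta =
  (-1) ^+ (a && b) *: ((B x xi : K) *: B y eta) - (B y xi : K) *: B x eta.
Proof.
move=> xia etab; have [Bl Br] := Bb.
move: x; apply: (hom_lin_eq (V := U)) => [||i x xi'].
- by have [] := pairT_bilin xi eta.
- apply: add_linear; first by apply: scale_linear; apply: rscale_linear.
  by apply: opp_linear; apply: scale_linear.
move: y; apply: (hom_lin_eq (V := U)) => [||j y yj].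
- by have [] := pairT_bilin xi eta.
- apply: add_linear; first by do 2!apply: scale_linear.
  by apply: opp_linear; apply: rscale_linear.
rewrite /pairT (skewize_hom (hb xi eta) xi' yj).
have kE z t c d : z \in part U c -> t \in part U d ->
    koszul (fun y xi => (B t xi : K) *: B y eta) z xi =
    (-1) ^+ (c && a) *: ((B t xi : K) *: B z eta).
  move=> zc td; apply: koszul_hom => //.
  by split=> u; [apply: scale_linear | apply: rscale_linear].
rewrite (kE _ _ j i) // (kE _ _ i j) //.
have E z t c d : z \in part U c -> t \in part W d ->
    B z t = if c == d then B z t else 0.
  by move=> zc td; case: eqVneq => // /(Be zc td).
rewrite (E x xi i a) // (E x eta i b) // (E y xi j a) // (E y eta j b) //.
case: i j a b {xia etab xi' yj kE E} => -[] [] [] /=;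
  by rewrite ?(scaler0, scale0r, expr0, expr1, scale1r, scaleN1r, opprK, subr0, sub0r, oppr0, addr0).
Qed.

Lemma pairT_skew2 x y : super_skew (pairT B x y).
Proof.
move=> a b xi eta xia etab; rewrite !(pairT_hom _ _ xia etab, pairT_hom _ _ etab xia).
rewrite [b && a]andbC scalerBr signrZK opprB.
by rewrite ![(B _ xi : K) *: _]mulrC.
Qed.

Lemma pair2_bilin : bilin (pair2 B).
Proof.
split=> Q.
  apply: ext2_lift_linear; split=> z; apply: ext2_lift_param => xi eta;
  by have [] := pairT_bilin xi eta.
apply: ext2_lift_param => x y.
by apply: ext2_lift_linear; exact: pairT_bilin2.
Qed.

Hypothesis K2 : 2%:R != 0 :> K.

Lemma pair2_wedge x y xi eta :
  pair2 B (wedge x y) (wedge xi eta) = pairT B x y xi eta.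
Proof.
rewrite /pair2 (ext2_liftE _ _ K2).
- by rewrite (ext2_liftE _ _ K2) //; [exact: pairT_bilin2 | exact: pairT_skew2].
- split=> z; apply: ext2_lift_param => xi' eta';
  by have [] := pairT_bilin xi' eta'.
move=> i j {}x {}y xi' yj; move: (wedge xi eta); apply: (ext2_eq (V := W)) => [||a b z t za tb].
- by apply: ext2_lift_linear; exact: pairT_bilin2.
- apply: opp_linear; apply: scale_linear.
  by apply: ext2_lift_linear; exact: pairT_bilin2.
rewrite !(ext2_liftE _ _ K2) ?(pairT_skew z t xi' yj) //;
  by [exact: pairT_bilin2 | exact: pairT_skew2].
Qed.

Lemma pair2_surj F : perfect B -> linear F -> exists P, forall Q, pair2 B P Q = F Q.
Proof.
move=> Bp FL; have [wl wr] := wedge_bilin W.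
pose f xi eta : K^o := F (wedge xi eta).
have fb : bilin f.
  by split=> z; [apply: (comp_linear FL (wl z)) | apply: (comp_linear FL (wr z))].
pose g := koszul f; have [gl gr] : bilin g by exact: koszul_bilin.
pose u k : U := repr B (pairDV (@dbasis K W k)).
have uE k w : B (u k) w = pairDV (dbasis k) w.
  by apply: (reprE Bp); case: (pairDV_bilin W).
pose P := (2%:R : K)^-1 *: \sum_k \sum_l
            (g (ebasis k) (ebasis l) : K) *: wedge (u k) (u l).
exists P; have [pl pr] := pair2_bilin.
apply: (ext2_eq (V := W)) => // a b xi eta xia etab.
rewrite /P (linZ (pl _)) (lin_sum (pl _)).
have gE (xi' eta' : W) : \sum_k \sum_l (g (ebasis k) (ebasis l) : K) *:
    ((B (u k) xi' : K) *: B (u l) eta') = g xi' eta'.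
  rewrite -[in RHS](ebasis_sum xi') (lin_sum (gl _)); apply: eq_bigr => k _.
  rewrite (linZ (gl _)) -[in RHS](ebasis_sum eta') (lin_sum (gr _)) scaler_sumr.
  apply: eq_bigr => l _; rewrite (linZ (gr _)) !uE.
  by rewrite /GRing.scale /= mulrC -mulrA; congr (_ * _); rewrite mulrC.
transitivity ((2%:R : K)^-1 *: ((-1) ^+ (a && b) *: g xi eta - g eta xi)).
  congr (_ *: _); rewrite -!gE scaler_sumr -sumrB /=.
  apply: eq_bigr => k _; rewrite (lin_sum (pl _)) scaler_sumr -sumrB.
  apply: eq_bigr => l _; rewrite (linZ (pl _)) pair2_wedge.
  rewrite (pairT_hom _ _ xia etab) scalerBr; congr (_ - _).
    exact: scalerC.
  by congr (_ *: _); exact: rscaleC.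
rewrite /g (koszul_hom fb xia etab) (koszul_hom fb etab xia).
rewrite signrZK /f (wedge_skew etab xia) (linN FL) (linZ FL) scalerN opprK.
rewrite signrZK -mulr2n -scaler_nat scalerA mulVf //.
by rewrite scale1r.
Qed.

End Pair.

Lemma pair2_flip U W (B : U -> W -> K^o) P Q :
  2%:R != 0 :> K -> bilin B -> even_form B ->
  pair2 B P Q = pair2 (fun w u => B u w) Q P.
Proof.
move=> K2 Bb Be; have Cb : bilin (fun w u => B u w) by case: Bb.
have Ce : even_form (fun w u => B u w).
  by move=> i j w u wi uj ij; apply: (Be j i) => //; rewrite eq_sym.
have [bl br] := pair2_bilin Bb; have [cl cr] := pair2_bilin Cb.
move: P; apply: (ext2_eq (V := U)) => // i j x y xi yj.
move: Q; apply: (ext2_eq (V := W)) => // a b xi0 eta xia etab.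
rewrite !pair2_wedge // (pairT_hom _ _ _ _ xia etab) // (pairT_hom _ _ _ _ xi yj) //.
have E z t c d : z \in part U c -> t \in part W d ->
    B z t = if c == d then B z t else 0.
  by move=> zc td; case: eqVneq => // /(Be _ _ _ _ zc td).
rewrite [(B x eta : K) *: _]rscaleC.
rewrite (E x xi0 i a) // (E x eta i b) // (E y xi0 j a) // (E y eta j b) //.
case: i j a b {xia etab xi yj E} => -[] [] [] /=;
  by rewrite ?(scaler0, scale0r, expr0, expr1, scale1r, scaleN1r, opprK, subr0, sub0r, oppr0, addr0).
Qed.

Lemma pair2_perfect U W (B : U -> W -> K^o) : 2%:R != 0 :> K -> even_form B ->
  perfect B -> perfect (fun w u => B u w) -> perfect (pair2 B).
Proof.
move=> K2 Be Bp Cp; have [Bb _ _] := Bp; have [Cb _ _] := Cp.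
have Ce : even_form (fun w u => B u w).
  by move=> i j w u wi uj ij; apply: (Be j i) => //; rewrite eq_sym.
split=> [|P E|F FL]; [exact: pair2_bilin | | exact: pair2_surj].
suff G0 (G : ext2 U -> K^o) : linear G -> G P = 0.
  rewrite -(ebasis_sum P) big1 // => i _.
  by rewrite (G0 (pairDV (dbasis i))) ?scale0r //; case: (pairDV_bilin (ext2 U)).
by move=> /(pair2_surj Cb Ce K2 Cp)[Q <-]; rewrite -(pair2_flip _ _ K2 Bb Be) E.
Qed.

End ExteriorPairing.

Section EvenPairing.
Variable K : fieldType.
Implicit Types U V W : superspace K.

Lemma even_part U W (B : U -> W -> K^o) i u : perfect B -> even_form B ->
  (forall j w, w \in part W j -> j != i -> B u w = 0) -> u \in part U i.
Proof.
move=> [[Bl Br] Bi _] Be u0.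
have : hc U (~~ i) u = 0.
  apply: Bi => w; rewrite -(sum_hc w) (lin_sum (Br _)) big1 // => j _.
  have [->|ji] := eqVneq j (~~ i); last first.
    by rewrite (Be _ _ _ _ (hc_in _ _) (hc_in _ _)) // eq_sym.
  have wN := hc_in (~~ i) w; have iN : ~~ i != i by case: (i).
  have := u0 _ _ wN iN; rewrite -{1}(sum_hc u) (lin_sum (Bl _)) (bigD1 (~~ i)) //=.
  rewrite big1 ?addr0 // => k ki; exact: (Be _ _ _ _ (hc_in _ _) wN ki).
move=> uN; have := sum_hc u; rewrite (bigD1 i) //= big1 ?addr0 => [<-|k].
  exact: hc_in.
by case: (i) uN k => ? [].
Qed.

Lemma pair2_even U W (B : U -> W -> K^o) :
  2%:R != 0 :> K -> bilin B -> even_form B -> even_form (pair2 B).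
Proof.
move=> K2 Bb Be p q P Q Pp Qq pq; have [pl pr] := pair2_bilin Bb.
rewrite -(hc_id Pp) -(hc_id Qq).
move: P {Pp}; apply: (ext2_eq (V := U) (g := fun _ => 0)) => [||i j x y xi yj].
- exact: (comp_linear (f := (pair2 B)^~ _)) (pl _) (lfun_linear _).
- by move=> a u v; rewrite scaler0 addr0.
rewrite (hcE _ (wedge_even xi yj)); case: eqVneq => [pE|_]; last first.
  exact: lin0 (pl _).
move: Q {Qq}; apply: (ext2_eq (V := W) (g := fun _ => 0)) => [||a b z t za tb].
- exact: (comp_linear (f := pair2 B _)) (pr _) (lfun_linear _).
- by move=> a u v; rewrite scaler0 addr0.
rewrite (hcE _ (wedge_even za tb)); case: eqVneq => [qE|_]; last first.
  exact: lin0 (pr _).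
rewrite pair2_wedge // (pairT_hom _ _ _ _ za tb) //.
have E u v c d : u \in part U c -> v \in part W d ->
    B u v = if c == d then B u v else 0.
  by move=> uc vd; case: eqVneq => // /(Be _ _ _ _ uc vd).
rewrite (E x z i a) // (E x t i b) // (E y z j a) // (E y t j b) //.
move: pq; rewrite pE qE; case: i j a b {xi yj za tb E pE qE} => -[] [] [] //= _;
  by rewrite ?(scaler0, scale0r, subr0).
Qed.

Lemma pchar0_neq2 : [pchar K] =i pred0 -> 2%:R != 0 :> K.
Proof. by move=> K0; apply/negP => K2; have := K0 2; rewrite !inE K2. Qed.

End EvenPairing.

Section HomLie.
Variable K : fieldType.
Implicit Types L M U V W : superspace K.

Definition hom_lie_superalgebra L (br : L -> L -> L) (al : 'End(L)) : Prop :=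
  [/\ bilin br, even_bilin br, even_map al, super_skew br
    & forall i j k x y z,
        x \in part L i -> y \in part L j -> z \in part L k ->
        (-1) ^+ (i && k) *: br (al x) (br y z)
        + (-1) ^+ (k && j) *: br (al z) (br x y)
        + (-1) ^+ (j && i) *: br (al y) (br z x) = 0].

Definition hl_multiplicative L (br : L -> L -> L) (al : 'End(L)) : Prop :=
  forall x y, al (br x y) = br (al x) (al y).

Definition hl_admissible L (br : L -> L -> L) (al : 'End(L)) : Prop :=
  forall x y, br (x - al (al x)) (al y) = 0.

Definition hl_representation L (br : L -> L -> L) (al : 'End(L))
    M (A : 'End(M)) (rho : L -> M -> M) : Prop :=
  [/\ bilin rho, even_bilin rho,
      forall x m, rho (al x) (A m) = A (rho x m)
    & forall i j x y m, x \in part L i -> y \in part L j ->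
        rho (br x y) (A m) =
        rho (al x) (rho y m) - (-1) ^+ (i && j) *: rho (al y) (rho x m)].

Definition matched_compat L (al : 'End(L)) M (br' : M -> M -> M) (al' : 'End(M))
    (rho : L -> M -> M) (rho' : M -> L -> L) : Prop :=
  forall i j k x y z,
    x \in part M i -> y \in part M j -> z \in part L k ->
    rho (al z) (br' x y) =
      br' (rho z x) (al' y)
      + (-1) ^+ (i && k) *: br' (al' x) (rho z y)
      + (-1) ^+ ((i && j) + (j && k)) *: rho (rho' y z) (al' x)
      - (-1) ^+ (i && k) *: rho (rho' x z) (al' y).

Definition matched_pair L (br : L -> L -> L) (al : 'End(L))
    M (br' : M -> M -> M) (al' : 'End(M))
    (rho : L -> M -> M) (rho' : M -> L -> L) : Prop :=
  [/\ hom_lie_superalgebra br al /\ hom_lie_superalgebra br' al',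
      hl_representation br al al' rho,
      hl_representation br' al' al rho',
      matched_compat al br' al' rho rho'
    & matched_compat al' br al rho' rho].

(* ad^*_x xi, determined by
   <[x, y], xi> = - (-1)^(|x||y|) <y, ad^*_x xi> *)
Definition coad V (br : V -> V -> V) (x : V) (xi : dual V) : dual V :=
  repr (fun zeta y => pairVD y zeta)
       (fun y => - koszul (fun x y => pairVD (br x y) xi) x y).

(* frakad^*_xi x, determined by
   <[xi, eta], x> = - (-1)^(|xi||eta|) <eta, frakad^*_xi x> *)
Definition cocoad V (brd : dual V -> dual V -> dual V) (xi : dual V) (x : V) : V :=
  repr (fun y eta => pairDV eta y)
       (fun eta => - koszul (fun xi eta => pairDV (brd xi eta) x) xi eta).

(* The extension of rho to \wedge^2 M:
   x . (u /\ v) = rho x u /\ A v + (-1)^(|x||u|) A u /\ rho x v *)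
Definition ext2_act L M (A : 'End(M)) (rho : L -> M -> M)
    (x : L) (P : ext2 M) : ext2 M :=
  ext2_lift (fun u v => wedge (rho x u) (A v)
                        + koszul (fun x u => wedge (A u) (rho x v)) x u) P.

(* The action on U dual to an action on W, determined by
   B (x . P) Q = - (-1)^(|x||P|) B P (x . Q) *)
Definition dual_act L U W (B : U -> W -> K^o) (act : L -> W -> W)
    (x : L) (P : U) : U :=
  repr B (fun Q => - koszul (fun x P => B P (act x Q)) x P).

Section Bialgebra.
Variables (V : superspace K) (br : V -> V -> V) (al : 'End(V)).
Variable brd : dual V -> dual V -> dual V.

(* <P, Xi> for P in \wedge^2 V and Xi in \wedge^2 V^*, and <Xi, P> *)
Definition pairVD2 : ext2 V -> ext2 (dual V) -> K^o := pair2 (@pairVD K V).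
Definition pairDV2 : ext2 (dual V) -> ext2 V -> K^o := pair2 (@pairDV K V).

(* Delta, determined by <Delta x, xi /\ eta> = <x, [xi, eta]> *)
Definition cobr (x : V) : ext2 V :=
  repr pairVD2 (ext2_lift (fun xi eta => pairVD x (brd xi eta))).

(* Delta^*, determined by <Delta^* xi, x /\ y> = <xi, [x, y]> *)
Definition dual_cobr (xi : dual V) : ext2 (dual V) :=
  repr pairDV2 (ext2_lift (fun x y => pairDV xi (br x y))).

(* ad_x on \wedge^2 V, and frakad_xi on \wedge^2 V^* *)
Definition ad2 : V -> ext2 V -> ext2 V :=
  dual_act pairVD2 (ext2_act (dual_map al) (coad br)).
Definition coad2 : dual V -> ext2 (dual V) -> ext2 (dual V) :=
  dual_act pairDV2 (ext2_act al (cocoad brd)).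

Definition superbialgebra_C1 : Prop :=
  forall i j k l (x y : V) (xi eta : dual V),
    x \in part V i -> y \in part V j ->
    xi \in part (dual V) k -> eta \in part (dual V) l ->
    pairVD2 (cobr (br x y)) (wedge (dual_map al xi) eta) =
      pairVD2 (ad2 (al x) (cobr y)) (wedge (dual_map al xi) eta)
      - (-1) ^+ (i && j)
        *: pairVD2 (ad2 (al y) (cobr x)) (wedge (dual_map al xi) eta).

Definition superbialgebra_C2 : Prop :=
  forall i j k l (xi eta : dual V) (x y : V),
    xi \in part (dual V) i -> eta \in part (dual V) j ->
    x \in part V k -> y \in part V l ->
    pairDV2 (dual_cobr (brd xi eta)) (wedge (al x) y) =
      pairDV2 (coad2 (dual_map al xi) (dual_cobr eta)) (wedge (al x) y)
      - (-1) ^+ (i && j)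
        *: pairDV2 (coad2 (dual_map al eta) (dual_cobr xi)) (wedge (al x) y).

Definition hom_lie_superbialgebra : Prop :=
  superbialgebra_C1 /\ superbialgebra_C2.

End Bialgebra.

Section Characterizations.
Hypothesis K0 : [pchar K] =i pred0.

Lemma coadP V (br : V -> V -> V) i j x y (xi : dual V) : bilin br ->
  x \in part V i -> y \in part V j ->
  pairVD (br x y) xi = - ((-1) ^+ (i && j) *: pairVD y (coad br x xi)).
Proof.
move=> [bl br'] xi' yj; have [L R] := pairVD_bilin V.
have fb : bilin (fun x y => pairVD (br x y) xi).
  by split=> z; apply: (comp_linear (L xi)).
rewrite /coad (reprE (pairVD_opp_perfect V)); last first.
  by apply: opp_linear; have [] := koszul_bilin fb.
by rewrite (koszul_hom fb xi' yj) scalerN signrZK opprK.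
Qed.

Lemma cocoadP V (brd : dual V -> dual V -> dual V) i j (xi eta : dual V) x :
  bilin brd -> xi \in part (dual V) i -> eta \in part (dual V) j ->
  pairDV (brd xi eta) x = - ((-1) ^+ (i && j) *: pairDV eta (cocoad brd xi x)).
Proof.
move=> [bl br'] xi' yj; have [L R] := pairDV_bilin V.
have fb : bilin (fun xi eta => pairDV (brd xi eta) x).
  by split=> z; apply: (comp_linear (L x)).
rewrite /cocoad (reprE (pairDV_opp_perfect V)); last first.
  by apply: opp_linear; have [] := koszul_bilin fb.
by rewrite (koszul_hom fb xi' yj) scalerN signrZK opprK.
Qed.

Lemma coad_bilin V (br : V -> V -> V) : bilin br -> bilin (coad br).
Proof.
move=> [bl br']; have [L R] := pairVD_bilin V.
have fb xi : bilin (fun x y => pairVD (br x y) xi).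
  by split=> z; apply: (comp_linear (L xi)).
split=> z; apply: (repr_linear (pairVD_opp_perfect V)); split=> t;
  apply: opp_linear; try by have [] := koszul_bilin (fb z).
- by apply: koszul_param => x y.
- by have [] := koszul_bilin (fb t).
Qed.

Lemma cocoad_bilin V (brd : dual V -> dual V -> dual V) :
  bilin brd -> bilin (cocoad brd).
Proof.
move=> [bl br']; have [L R] := pairDV_bilin V.
have fb x : bilin (fun xi eta => pairDV (brd xi eta) x).
  by split=> z; apply: (comp_linear (L x)).
split=> z; apply: (repr_linear (pairDV_opp_perfect V)); split=> t;
  apply: opp_linear; try by have [] := koszul_bilin (fb z).
- by apply: koszul_param => x y.
- by have [] := koszul_bilin (fb t).
Qed.

Section Ext2Act.
Variables (L M : superspace K) (A : 'End(M)) (rho : L -> M -> M).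
Hypotheses (rb : bilin rho) (re : even_bilin rho) (Ae : even_map A).

Let F x (u v : M) : ext2 M := wedge (rho x u) (A v)
                        + koszul (fun x u => wedge (A u) (rho x v)) x u.

Let kb v : bilin (fun x u => wedge (A u) (rho x v)).
Proof.
have [rl rr] := rb; have [wl wr] := wedge_bilin M.
by split=> z; [apply: (comp_linear (wr _)) | apply: (comp_linear (wl _)); exact: lfun_linear].
Qed.

Let F_linear u v : linear (fun x => F x u v).
Proof.
have [rl rr] := rb; have [wl wr] := wedge_bilin M; have [kl kr] := koszul_bilin (kb v).
by apply: add_linear => //; apply: (comp_linear (wl _)).
Qed.

Let F_bilin x : bilin (F x).
Proof.
have [rl rr] := rb; have [wl wr] := wedge_bilin M.
split=> z; apply: add_linear.
- exact: (comp_linear (wl _)).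
- by have [] := koszul_bilin (kb z).
- exact: (comp_linear (wr _)) (lfun_linear A).
- by apply: koszul_param => t u; apply: (comp_linear (wr _)).
Qed.

Let F_hom i j x u v : x \in part L i -> u \in part M j ->
  F x u v = wedge (rho x u) (A v) + (-1) ^+ (i && j) *: wedge (A u) (rho x v).
Proof. by move=> xi uj; rewrite /F (koszul_hom (kb v) xi uj). Qed.

Let F_skew x : super_skew (F x).
Proof.
move=> j k u v uj vk; move: x.
apply: (hom_lin_eq (V := L)) => [||i x xi]; first exact: F_linear.
  exact/opp_linear/scale_linear/F_linear.
rewrite (F_hom _ xi uj) (F_hom _ xi vk).
rewrite (wedge_skew (re xi uj) (Ae vk)) (wedge_skew (Ae uj) (re xi vk)).
rewrite scalerDr opprD addrC !scalerN !scalerA -!scaleNr.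
by congr (_ *: _ + _ *: _); case: (i) (j) (k) => -[] [];
  rewrite /= ?expr0 ?expr1 ?mulr1 ?mul1r ?mulN1r ?opprK.
Qed.

Lemma ext2_act_wedge i j x u v : x \in part L i -> u \in part M j ->
  ext2_act A rho x (wedge u v) =
  wedge (rho x u) (A v) + (-1) ^+ (i && j) *: wedge (A u) (rho x v).
Proof.
move=> xi uj; rewrite -(F_hom _ xi uj); apply: ext2_liftE.
- exact: pchar0_neq2.
- exact: F_bilin.
- exact: F_skew.
Qed.

Lemma ext2_act_bilin : bilin (ext2_act A rho).
Proof.
split=> z; last exact: ext2_lift_linear (F_bilin z).
by apply: ext2_lift_param => u v; exact: F_linear.
Qed.

End Ext2Act.

Lemma dual_actP L U W (B : U -> W -> K^o) (act : L -> W -> W) i j x P Q :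
  perfect B -> bilin act -> x \in part L i -> P \in part U j ->
  B (dual_act B act x P) Q = - ((-1) ^+ (i && j) *: B P (act x Q)).
Proof.
move=> Bp [al ar] xi Pj; have [[Bl Br] _ _] := Bp.
have fb Q' : bilin (fun x P => B P (act x Q')).
  by split=> z //; apply: (comp_linear (Br _)).
rewrite (reprE Bp); first by rewrite (koszul_hom (fb Q) xi Pj).
by apply: opp_linear; apply: koszul_param => y R; apply: (comp_linear (Br _)).
Qed.

Lemma pairVD2_perfect V : perfect (@pairVD2 V).
Proof.
apply: pair2_perfect; first exact: pchar0_neq2.
- exact: pairVD_even.
- exact: pairVD_perfect.
- exact: pairVD_opp_perfect.
Qed.

Lemma pairDV2_perfect V : perfect (@pairDV2 V).
Proof.
apply: pair2_perfect; first exact: pchar0_neq2.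
- exact: pairDV_even.
- exact: pairDV_perfect.
- exact: pairDV_opp_perfect.
Qed.

Lemma cobrP V (brd : dual V -> dual V -> dual V) x xi eta :
  bilin brd -> super_skew brd ->
  pairVD2 (cobr brd x) (wedge xi eta) = pairVD x (brd xi eta).
Proof.
move=> [bl br] bs; have [L R] := pairVD_bilin V.
have fb : bilin (fun xi eta => pairVD x (brd xi eta)).
  by split=> z; apply: (comp_linear (R x)).
rewrite (reprE (pairVD2_perfect V)); last exact: ext2_lift_linear.
rewrite ext2_liftE //; first exact: pchar0_neq2.
by move=> i j u v ui vj; rewrite (bs i j u v) // (linN (R x)) (linZ (R x)).
Qed.

Lemma dual_cobrP V (br : V -> V -> V) xi x y : bilin br -> super_skew br ->
  pairDV2 (dual_cobr br xi) (wedge x y) = pairDV xi (br x y).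
Proof.
move=> [bl br'] bs; have [L R] := pairDV_bilin V.
have fb : bilin (fun x y => pairDV xi (br x y)).
  by split=> z; apply: (comp_linear (R xi)).
rewrite (reprE (pairDV2_perfect V)); last exact: ext2_lift_linear.
rewrite ext2_liftE //; first exact: pchar0_neq2.
by move=> i j u v ui vj; rewrite (bs i j u v) // (linN (R xi)) (linZ (R xi)).
Qed.

Lemma cobr_even V (brd : dual V -> dual V -> dual V) :
  bilin brd -> super_skew brd -> even_bilin brd -> even_map (cobr brd).
Proof.
move=> bb bs be i x xi; have [L R] := pairVD_bilin V.
have [[pl pr] _ _] := pairVD2_perfect V.
apply: (even_part (pairVD2_perfect V)) => [|q Q Qq qi].
  apply: pair2_even; [exact: pchar0_neq2 | exact: pairVD_bilin | exact: pairVD_even].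
rewrite -(hc_id Qq); move: Q {Qq}.
apply: (ext2_eq (V := dual V) (g := fun _ => 0)) => [||a b u v ua vb].
- exact: (comp_linear (f := pairVD2 _)) (pr _) (lfun_linear _).
- by move=> c u v; rewrite scaler0 addr0.
rewrite (hcE _ (wedge_even ua vb)); case: eqVneq => [qE|_]; last exact: lin0 (pr _).
by rewrite cobrP // (pairVD_even xi (be _ _ _ _ ua vb)) // -qE eq_sym.
Qed.

Lemma dual_cobr_even V (br : V -> V -> V) :
  bilin br -> super_skew br -> even_bilin br -> even_map (dual_cobr br).
Proof.
move=> bb bs be i xi xii; have [L R] := pairDV_bilin V.
have [[pl pr] _ _] := pairDV2_perfect V.
apply: (even_part (pairDV2_perfect V)) => [|q Q Qq qi].
  apply: pair2_even; [exact: pchar0_neq2 | exact: pairDV_bilin | exact: pairDV_even].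
rewrite -(hc_id Qq); move: Q {Qq}.
apply: (ext2_eq (V := V) (g := fun _ => 0)) => [||a b u v ua vb].
- exact: (comp_linear (f := pairDV2 _)) (pr _) (lfun_linear _).
- by move=> c u v; rewrite scaler0 addr0.
rewrite (hcE _ (wedge_even ua vb)); case: eqVneq => [qE|_]; last exact: lin0 (pr _).
by rewrite dual_cobrP // (pairDV_even xii (be _ _ _ _ ua vb)) // -qE eq_sym.
Qed.

Lemma ad2P V (br : V -> V -> V) al i j x P Q : bilin br -> x \in part V i ->
  P \in part (ext2 V) j ->
  pairVD2 (ad2 br al x P) Q =
  - ((-1) ^+ (i && j) *: pairVD2 P (ext2_act (dual_map al) (coad br) x Q)).
Proof.
move=> bb; apply: dual_actP; first exact: pairVD2_perfect.
exact/ext2_act_bilin/coad_bilin.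
Qed.

Lemma coad2P V (brd : dual V -> dual V -> dual V) al i j xi P Q :
  bilin brd -> xi \in part (dual V) i -> P \in part (ext2 (dual V)) j ->
  pairDV2 (coad2 al brd xi P) Q =
  - ((-1) ^+ (i && j) *: pairDV2 P (ext2_act al (cocoad brd) xi Q)).
Proof.
move=> bb; apply: dual_actP; first exact: pairDV2_perfect.
exact/ext2_act_bilin/cocoad_bilin.
Qed.

End Characterizations.

Definition dsum_inl U W : 'Hom(U, (U * W)%type) := linfun (fun u : U => (u, 0 : W)).
Definition dsum_inr U W : 'Hom(W, (U * W)%type) := linfun (fun w : W => (0 : U, w)).

Definition dsum_part U W (i : bool) : {vspace (U * W)%type} :=
  (dsum_inl U W @: part U i + dsum_inr U W @: part W i)%VS.

Lemma dsum_inlE U W u : dsum_inl U W u = (u, 0).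
Proof.
by rewrite linfunE // => a v w; congr pair; rewrite /= scaler0 addr0.
Qed.

Lemma dsum_inrE U W w : dsum_inr U W w = (0, w).
Proof.
by rewrite linfunE // => a v w'; congr pair; rewrite /= scaler0 addr0.
Qed.

Lemma dsum_partP U W i (p : (U * W)%type) :
  (p \in dsum_part U W i) = (p.1 \in part U i) && (p.2 \in part W i).
Proof.
apply/memv_addP/andP => [[u /memv_imgP[x xi ->]] [w /memv_imgP[y yi ->]] ->|[p1 p2]].
  by rewrite dsum_inlE dsum_inrE /= addr0 add0r.
exists (p.1, 0); first by rewrite -dsum_inlE memv_img.
exists (0, p.2); first by rewrite -dsum_inrE memv_img.
by case: p {p1 p2} => u w; congr pair; rewrite /= ?addr0 ?add0r.
Qed.

Lemma dsum_full U W : (dsum_part U W false + dsum_part U W true)%VS = fullv.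
Proof.
apply/vspaceP => -[u w]; rewrite memvf; apply/memv_addP.
exists (hc U false u, hc W false w); first by rewrite dsum_partP !hc_in.
exists (hc U true u, hc W true w); first by rewrite dsum_partP !hc_in.
by congr pair; rewrite /= addrC -[LHS]sum_hc big_bool.
Qed.

Lemma dsum_direct U W : (dsum_part U W false :&: dsum_part U W true)%VS = 0%VS.
Proof.
apply/vspaceP => -[u w]; rewrite memv0 memv_cap; apply/andP/eqP => [[]|->].
  rewrite !dsum_partP => /andP[/= u0 w0] /andP[/= u1 w1].
  congr pair; apply/eqP; rewrite -memv0.
    by rewrite -(part_direct U) memv_cap u0.
  by rewrite -(part_direct W) memv_cap w0.
by rewrite !mem0v.
Qed.

Definition dsum U W : superspace K := Superspace (dsum_full U W) (dsum_direct U W).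

(* io identifies (L, br, al) with a Hom-Lie sub-superalgebra of (M, brM, phi) *)
Definition sub_embedding L (br : L -> L -> L) (al : 'End(L))
    M (brM : M -> M -> M) (phi : 'End(M)) (io : 'Hom(L, M)) : Prop :=
  [/\ injective io, even_map io,
      forall x y, io (br x y) = brM (io x) (io y)
    & forall x, io (al x) = phi (io x)].

Definition manin_supertriple M (brM : M -> M -> M) (phi : 'End(M))
    L (br : L -> L -> L) (al : 'End(L)) L' (br' : L' -> L' -> L') (al' : 'End(L'))
    (io : 'Hom(L, M)) (io' : 'Hom(L', M)) (S : M -> M -> K^o) : Prop :=
  [/\ [/\ hom_lie_superalgebra brM phi, hom_lie_superalgebra br al
        & hom_lie_superalgebra br' al'],
      [/\ bilin S,
          forall i j v w, v \in part M i -> w \in part M j ->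
            S v w = (-1) ^+ (i && j) *: S w v
        & forall v, (forall w, S v w = 0) -> v = 0],
      (forall x y z, S (brM x y) z = S x (brM y z)) /\
      (forall x y, S (phi x) y = S x (phi y)),
      [/\ sub_embedding br al brM phi io, sub_embedding br' al' brM phi io',
          forall x y, S (io x) (io y) = 0 & forall x y, S (io' x) (io' y) = 0]
    & (limg io + limg io')%VS = fullv /\ (limg io :&: limg io')%VS = 0%VS].

(* S (x + xi) (y + eta) = <x, eta> + <xi, y> *)
Definition std_form V (u v : dsum V (dual V)) : K^o :=
  pairVD (u : (V * dual V)%type).1 (v : (V * dual V)%type).2
  + pairDV (u : (V * dual V)%type).2 (v : (V * dual V)%type).1.

End HomLie.

(* Main.v *)
Require Import Defs.
From mathcomp Require Import all_boot all_order all_algebra.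
From mathcomp Require Import ring.
Import GRing.Theory.
Local Open Scope ring_scope.

Set Implicit Arguments.
Unset Strict Implicit.
Unset Printing Implicit Defensive.

(** All the identities are tested against the pairing of [g] and its dual.

    (1) <-> (2): paired with a linear form [eta], the compatibility condition of
    the matched pair for [frakad^*_xi [x, y]] becomes, up to the sign
    [(-1)^((|x|+|y|)|xi|)], condition (C1) evaluated on [al^* xi /\ eta];
    admissibility of [g^*] removes the extra [al^*^2] on [xi], because
    [ad^*_(al y) eta] lies in the image of [al^*].  (C2) is the same statement
    with [g] and [g^*] exchanged.  That [ad^*] and [frakad^*] are
    representations follows from multiplicativity and admissibility alone.

    (2) <-> (3): invariance and nondegeneracy of the form leave only one
    candidate for the bracket of [g + g^*], the bicrossed one
    [[x, eta] = ad^*_x eta - (-1)^(|x||eta|) frakad^*_eta x], which is always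
    invariant; its Hom-Jacobi identity splits into the representation and
    compatibility conditions of the matched pair. *)

(** Nondegeneracy reduces an equality of vectors to their pairings. Since these are linear in [w],
    homogeneous test vectors suffice, and these are the vectors for which the Koszul signs are
    explicit. *)
Lemma perfect_inj (K : fieldType) (U W : superspace K) (B : U -> W -> K^o) u v :
  perfect B -> (forall (j : bool) w, w \in part W j -> B u w = B v w) -> u = v.
Proof.
move=> [[Bl Br] E _] uv; apply/eqP; rewrite -subr_eq0; apply/eqP/E => w.
rewrite (linD (Bl w)) (linN (Bl w)); apply/eqP; rewrite subr_eq0; apply/eqP.
by move: w; apply: hom_lin_eq => //; exact: Br.
Qed.

(** * The bicrossed bracket on a direct sum *)

Section Bowtie.
Variable K : fieldType.
Implicit Types L M : superspace K.

(** Turns identities of vectors into identities of scalars, where [ring] can deal with the signs. *)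
Lemma pairDV_inj L (u v : L) : (forall xi, pairDV xi u = pairDV xi v) -> u = v.
Proof. by move=> uv; apply: (perfect_inj (pairDV_opp_perfect L)) => j xi _; exact: uv. Qed.

Lemma scaleKE (a : K) (b : K^o) : a *: b = (a : K) * (b : K) :> K.
Proof. by []. Qed.

(** The Hom-Jacobi identity solved for its first term, to serve as a rewrite rule. *)
Lemma hom_jacobi L (br : L -> L -> L) al i j k x y z :
  hom_lie_superalgebra br al ->
  x \in part L i -> y \in part L j -> z \in part L k ->
  br (al x) (br y z) = - ((-1) ^+ (i && k) *:
     ((-1) ^+ (k && j) *: br (al z) (br x y) + (-1) ^+ (j && i) *: br (al y) (br z x))).
Proof.
move=> [_ _ _ _ J] xi yj zk; have := J _ _ _ _ _ _ xi yj zk.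
by rewrite -addrA => /(canRL (addrK _)); rewrite sub0r => /(canRL (signrZK _)); rewrite scalerN.
Qed.

(** The [L]-component of the bicrossed bracket of [x + xi] (parity [i]) and [y + eta] (parity [j]).
    Exchanging the roles of [L] and [M] gives the [M]-component. *)
Definition bowtie_comp L M (br : L -> L -> L) (rho' : M -> L -> L) (i j : bool)
    x xi y eta :=
  br x y + rho' xi y - (-1) ^+ (i && j) *: rho' eta x.

(** The [L]-component of the Hom-Jacobi sum of [x + xi], [y + eta] and [z + zeta]. *)
Definition bowtie_cyclic L M (brL : L -> L -> L) (brM : M -> M -> M)
    (aL : 'End(L)) (aM : 'End(M)) (rho : L -> M -> M) (rho' : M -> L -> L)
    (i j k : bool) x xi y eta z zeta : L :=
  let b1 := bowtie_comp brL rho' in let b2 := bowtie_comp brM rho in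
  (-1) ^+ (i && k) *: b1 i (j (+) k) (aL x) (aM xi) (b1 j k y eta z zeta) (b2 j k eta y zeta z)
  + (-1) ^+ (k && j) *: b1 k (i (+) j) (aL z) (aM zeta) (b1 i j x xi y eta) (b2 i j xi x eta y)
  + (-1) ^+ (j && i) *: b1 j (k (+) i) (aL y) (aM eta) (b1 k i z zeta x xi) (b2 k i zeta z xi x).

(** The terms sort by the number of factors taken from [M]: none gives Hom-Jacobi in [L], one gives
    the compatibility condition (three instances), two give the representation condition for [rho']
    (three instances), and three contribute nothing to the [L]-component. *)
Lemma bowtie_comp_jacobi L M (brL : L -> L -> L) (brM : M -> M -> M)
    (aL : 'End(L)) (aM : 'End(M)) (rho : L -> M -> M) (rho' : M -> L -> L) :
  hom_lie_superalgebra brL aL -> bilin rho ->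
  hl_representation brM aM aL rho' ->
  matched_compat aM brL aL rho' rho ->
  forall i j k x y z xi eta zeta,
  x \in part L i -> y \in part L j -> z \in part L k ->
  xi \in part M i -> eta \in part M j -> zeta \in part M k ->
  bowtie_cyclic brL brM aL aM rho rho' i j k x xi y eta z zeta = 0.
Proof.
move=> hL [rl rr] [[rl' rr'] re' _ rep] comp i j k x y z xi eta zeta.
move=> xi1 yj zk xii etaj zetak.
have [[bl br] _ ae sk _] := hL.
apply: pairDV_inj => f; have [_ /(_ f) fL] := pairDV_bilin L.
have F u v : u = v -> pairDV f u = pairDV f v by move=> ->.
have := F _ _ (hom_jacobi hL xi1 yj zk).
have := F _ _ (rep _ _ _ _ x etaj zetak).
have := F _ _ (rep _ _ _ _ y zetak xii).
have := F _ _ (rep _ _ _ _ z xii etaj).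
have := F _ _ (comp _ _ _ _ _ _ xi1 yj zetak).
have := F _ _ (comp _ _ _ _ _ _ yj zk xii).
have := F _ _ (comp _ _ _ _ _ _ zk xi1 etaj).
(* Skew-symmetry gives the brackets in the compatibility conditions the shape [br (aL _) (rho' _ _)]
   that they have in the Jacobi sum. *)
rewrite (sk _ _ _ _ (re' _ _ _ _ xii yj) (ae _ _ zk)).
rewrite (sk _ _ _ _ (re' _ _ _ _ etaj zk) (ae _ _ xi1)).
rewrite (sk _ _ _ _ (re' _ _ _ _ zetak xi1) (ae _ _ yj)).
rewrite /bowtie_cyclic /bowtie_comp.
do !rewrite ?(linD (br _)) ?(linN (br _)) ?(linZ (br _)) ?(linD (rr' _)) ?(linN (rr' _))
  ?(linZ (rr' _)) ?(linD (rl' _)) ?(linN (rl' _)) ?(linZ (rl' _)) ?(linD fL) ?(linN fL) ?(linZ fL).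
(* Each of the seven relations eliminates one term. What remains is a scalar identity for each of
   the eight choices of parities. *)
rewrite (lin0 fL) => -> -> -> -> -> -> ->.
case: i {xi1 xii}; case: j {yj etaj}; case: k {zk zetak}; rewrite ?expr0 ?expr1 !scaleKE /=.
all: ring.
Qed.

(** On two elements of [L] and one of [M], the Jacobi sum keeps only the terms of one compatibility
    condition. *)
Lemma bowtie_comp_compat L M (brL : L -> L -> L) (brM : M -> M -> M)
    (aL : 'End(L)) (aM : 'End(M)) (rho : L -> M -> M) (rho' : M -> L -> L) :
  hom_lie_superalgebra brL aL -> bilin brM -> bilin rho ->
  bilin rho' -> even_bilin rho' ->
  (forall i j k x y zeta,
     x \in part L i -> y \in part L j -> zeta \in part M k ->
     bowtie_cyclic brL brM aL aM rho rho' i j k x 0 y 0 0 zeta = 0) ->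
  matched_compat aM brL aL rho' rho.
Proof.
move=> [[bl br] _ ae sk _] [bMl bMr] [rl rr] [rl' rr'] re' C i j k x y zeta xi1 yj zetak.
apply: pairDV_inj => f.
have [_ /(_ f) fL] := pairDV_bilin L.
rewrite (sk _ _ _ _ (re' _ _ _ _ zetak xi1) (ae _ _ yj)).
have := congr1 (pairDV f) (C _ _ _ _ _ _ xi1 yj zetak).
rewrite /bowtie_cyclic /bowtie_comp !linear0.
do !rewrite ?(lin0 (br _)) ?(lin0 (bl _)) ?(lin0 (bMr _)) ?(lin0 (bMl _)) ?(lin0 (rr _))
  ?(lin0 (rl _)) ?(lin0 (rr' _)) ?(lin0 (rl' _)) ?scaler0 ?oppr0 ?addr0 ?add0r.
do !rewrite ?(linD (br _)) ?(linN (br _)) ?(linZ (br _)) ?(linD (rr' _)) ?(linN (rr' _))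
  ?(linZ (rr' _)) ?(linD (rl' _)) ?(linN (rl' _)) ?(linZ (rl' _)) ?(linD fL) ?(linN fL) ?(linZ fL).
rewrite (lin0 fL) => E; apply/eqP; rewrite -subr_eq0; apply/eqP.
(* The difference of the two sides of the condition is the Jacobi sum times the sign
   [(-1) ^+ (k && j)]. *)
rewrite -[RHS](scaler0 _ ((-1) ^+ (k && j))) -E.
case: i {xi1 E}; case: j {yj}; case: k {zetak}; rewrite /= ?expr0 ?expr1 !scaleKE /=.
all: ring.
Qed.

Lemma pair_ext (A B : Type) (p q : A * B) : p.1 = q.1 -> p.2 = q.2 -> p = q.
Proof. by case: p q => [? ?] [? ?] /= -> ->. Qed.

Lemma dsum_pairP L M i (x : L) (xi : M) :
  reflect (x \in part L i /\ xi \in part M i) (((x, xi) : dsum L M) \in part (dsum L M) i).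
Proof. by rewrite dsum_partP; exact: andP. Qed.

(** The sign of the last term depends on parities; [koszul] extends it bilinearly, so that the
    bracket is defined on all vectors. *)
Definition bowtie L M (brL : L -> L -> L) (brM : M -> M -> M)
    (rho : L -> M -> M) (rho' : M -> L -> L) (p q : dsum L M) : dsum L M :=
  let (x, xi) := (p : (L * M)%type) in let (y, eta) := (q : (L * M)%type) in
  (brL x y + rho' xi y - koszul (fun x eta => rho' eta x) x eta,
   brM xi eta + rho x eta - koszul (fun xi y => rho y xi) xi y).

Definition dsum_map L M (aL : 'End(L)) (aM : 'End(M)) : 'End(dsum L M) :=
  linfun (fun p : dsum L M =>
    (aL (p : (L * M)%type).1, aM (p : (L * M)%type).2) : dsum L M).

Lemma dsum_mapE L M (aL : 'End(L)) (aM : 'End(M)) x xi :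
  dsum_map aL aM ((x, xi) : dsum L M) = (aL x, aM xi).
Proof.
rewrite /dsum_map linfunE // => a [u v] [u' v'].
by congr pair; rewrite /= linearP.
Qed.

(** * Bilinearity, parity, skew-symmetry and Hom-Jacobi sum of the bicrossed bracket *)

Section BowtieTheory.
Variables (L M : superspace K) (brL : L -> L -> L) (brM : M -> M -> M).
Variables (aL : 'End(L)) (aM : 'End(M)) (rho : L -> M -> M) (rho' : M -> L -> L).
Hypotheses (bL : bilin brL) (bM : bilin brM) (br : bilin rho) (br' : bilin rho').
Hypotheses (eL : even_bilin brL) (eM : even_bilin brM).
Hypotheses (er : even_bilin rho) (er' : even_bilin rho').
Let bow := bowtie brL brM rho rho'.

Lemma bowtie_hom i j x xi y eta :
  x \in part L i -> xi \in part M i -> y \in part L j -> eta \in part M j ->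
  bow (x, xi) (y, eta) =
    (bowtie_comp brL rho' i j x xi y eta, bowtie_comp brM rho i j xi x eta y).
Proof.
move=> xi1 xii yj etaj; have [rl rr] := br; have [rl' rr'] := br'.
rewrite /bow /bowtie (koszul_hom _ xi1 etaj); last by split.
by rewrite (koszul_hom _ xii yj); last by split.
Qed.

Lemma bowtie_bilin : bilin bow.
Proof.
have [rl rr] := br; have [rl' rr'] := br'.
have [bLl bLr] := bL; have [bMl bMr] := bM.
have [kl kr] : bilin (koszul (fun xi y => rho y xi)) by apply: koszul_bilin.
have [kl' kr'] : bilin (koszul (fun x eta => rho' eta x)) by apply: koszul_bilin.
have arr (Z : zmodType) (a b c d e f : Z) :
    a + b + (c + d) - (e + f) = a + c - e + (b + d - f).
  by rewrite opprD [a + b + _]addrACA [LHS]addrACA.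
split=> -[z zeta] a [u w] [u' w']; apply: pair_ext;
  by rewrite /bow /bowtie /= !(bLl, bLr, bMl, bMr, rl, rr, rl', rr', kl, kr, kl', kr') arr -scalerDr -scalerBr.
Qed.

Lemma bowtie_inl x y : bow (x, 0) (y, 0) = (brL x y, 0).
Proof.
have [rl rr] := br; have [rl' rr'] := br'; have [_ bMr] := bM.
have [kl kr] : bilin (koszul (fun xi y => rho y xi)) by apply: koszul_bilin.
have [kl' kr'] : bilin (koszul (fun x eta => rho' eta x)) by apply: koszul_bilin.
by rewrite /bow /bowtie (lin0 (rl' _)) (lin0 (kr' _)) (lin0 (kl _)) (lin0 (rr _))
  (lin0 (bMr _)) !subr0 !addr0.
Qed.

Lemma bowtie_inr x y : bow (0, x) (0, y) = (0, brM x y).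
Proof.
have [rl rr] := br; have [rl' rr'] := br'; have [_ bLr] := bL.
have [kl kr] : bilin (koszul (fun xi y => rho y xi)) by apply: koszul_bilin.
have [kl' kr'] : bilin (koszul (fun x eta => rho' eta x)) by apply: koszul_bilin.
by rewrite /bow /bowtie (lin0 (rr' _)) (lin0 (kl' _)) (lin0 (kr _)) (lin0 (rl _))
  (lin0 (bLr _)) !subr0 !addr0.
Qed.

Lemma bowtie_even : even_bilin bow.
Proof.
move=> i j [x xi] [y eta] /dsum_pairP[xi1 xii] /dsum_pairP[yj etaj].
rewrite (bowtie_hom xi1 xii yj etaj) /bowtie_comp; apply/dsum_pairP; split.
  apply: memvB; first by apply: memvD; [exact: eL | exact: er'].
  by apply: memvZ; rewrite addbC; exact: er'.
apply: memvB; first by apply: memvD; [exact: eM | exact: er].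
by apply: memvZ; rewrite addbC; exact: er.
Qed.

Lemma bowtie_skew : super_skew brL -> super_skew brM -> super_skew bow.
Proof.
have arr (Z : lmodType K) (b : bool) (u v w : Z) :
    - ((-1) ^+ b *: u) + v - (-1) ^+ b *: w =
    - ((-1) ^+ b *: (u + w - (-1) ^+ b *: v)).
  by rewrite scalerBr signrZK opprB scalerDr opprD [LHS]addrAC [LHS]addrC.
move=> sL sM i j [x xi] [y eta] /dsum_pairP[xi1 xii] /dsum_pairP[yj etaj].
rewrite (bowtie_hom xi1 xii yj etaj) (bowtie_hom yj etaj xi1 xii) /bowtie_comp.
by rewrite (sL _ _ _ _ xi1 yj) (sM _ _ _ _ xii etaj) [j && i]andbC !arr.
Qed.

(** The two components of the Jacobi sum are one expression with the summands exchanged, so each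
    statement about it is proved once and applied twice. Evenness makes the inner brackets
    homogeneous, so that [bowtie_hom] also applies to the outer ones. *)
Lemma bowtie_cyclicE i j k x y z xi eta zeta : even_map aL -> even_map aM ->
  x \in part L i -> y \in part L j -> z \in part L k ->
  xi \in part M i -> eta \in part M j -> zeta \in part M k ->
  let phi := dsum_map aL aM in
  (-1) ^+ (i && k) *: bow (phi (x, xi)) (bow (y, eta) (z, zeta))
  + (-1) ^+ (k && j) *: bow (phi (z, zeta)) (bow (x, xi) (y, eta))
  + (-1) ^+ (j && i) *: bow (phi (y, eta)) (bow (z, zeta) (x, xi)) =
  (bowtie_cyclic brL brM aL aM rho rho' i j k x xi y eta z zeta,
   bowtie_cyclic brM brL aM aL rho' rho i j k xi x eta y zeta z).
Proof.
move=> aLe aMe xi1 yj zk xii etaj zetak phi; rewrite /phi !dsum_mapE.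
have P i' x' xi' (h : x' \in part L i') (h' : xi' \in part M i') :
  ((x', xi') : dsum L M) \in part (dsum L M) i' by apply/dsum_pairP.
move: (bowtie_even (P _ _ _ xi1 xii) (P _ _ _ yj etaj)).
move: (bowtie_even (P _ _ _ yj etaj) (P _ _ _ zk zetak)).
move: (bowtie_even (P _ _ _ zk zetak) (P _ _ _ xi1 xii)).
rewrite (bowtie_hom xi1 xii yj etaj) (bowtie_hom yj etaj zk zetak) (bowtie_hom zk zetak xi1 xii).
move=> /dsum_pairP[? ?] /dsum_pairP[? ?] /dsum_pairP[? ?].
rewrite (bowtie_hom (i := i) (j := j (+) k)) ?aLe ?aMe //.
rewrite (bowtie_hom (i := k) (j := i (+) j)) ?aLe ?aMe //.
by rewrite (bowtie_hom (i := j) (j := k (+) i)) ?aLe ?aMe.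
Qed.

End BowtieTheory.

Lemma matched_pair_hom_lie L M (brL : L -> L -> L) (aL : 'End(L))
    (brM : M -> M -> M) (aM : 'End(M)) rho rho' :
  matched_pair brL aL brM aM rho rho' ->
  hom_lie_superalgebra (bowtie brL brM rho rho') (dsum_map aL aM).
Proof.
move=> [[hL hM] repL repM c c']; have [bL eL aLe sL _] := hL.
have [bM eM aMe sM _] := hM; have [br er _ _] := repL; have [br' er' _ _] := repM.
split=> [|||| i j k [x xi] [y eta] [z zeta]]; first exact: bowtie_bilin.
- exact: bowtie_even.
- by move=> i [x xi]; rewrite dsum_mapE => /dsum_pairP[/aLe ? /aMe ?]; apply/dsum_pairP.
- exact: bowtie_skew.
move=> /dsum_pairP[xi1 xii] /dsum_pairP[yj etaj] /dsum_pairP[zk zetak].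
rewrite (bowtie_cyclicE br br' eL eM er er' aLe aMe xi1 yj zk xii etaj zetak).
rewrite (bowtie_comp_jacobi hL br repM c') // (bowtie_comp_jacobi hM br' repL c) //.
Qed.

(** Only the compatibility conditions are extracted here. For the coadjoint maps, the representation
    conditions come from [dual_action_rep]. *)
Lemma hom_lie_bowtie_compat L M (brL : L -> L -> L) (aL : 'End(L))
    (brM : M -> M -> M) (aM : 'End(M)) rho rho' :
  hom_lie_superalgebra brL aL -> hom_lie_superalgebra brM aM ->
  bilin rho -> even_bilin rho -> bilin rho' -> even_bilin rho' ->
  hom_lie_superalgebra (bowtie brL brM rho rho') (dsum_map aL aM) ->
  matched_compat aL brM aM rho rho' /\ matched_compat aM brL aL rho' rho.
Proof.
move=> hL hM br er br' er' [_ be _ _ J].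
have [bL eL aLe _ _] := hL; have [bM eM aMe _ _] := hM.
have C i j k x y z xi eta zeta xi1 yj zk xii etaj zetak :=
  etrans (esym (bowtie_cyclicE br br' eL eM er er' aLe aMe xi1 yj zk xii etaj zetak))
    (J i j k (x, xi) (y, eta) (z, zeta)
      (introT (dsum_pairP _ _ _) (conj xi1 xii)) (introT (dsum_pairP _ _ _) (conj yj etaj))
      (introT (dsum_pairP _ _ _) (conj zk zetak))).
split.
  apply: (bowtie_comp_compat (brM := brL)) => // i j k x y zeta xi1 yj zetak.
  (* Two elements of [M] and one of [L], read in the [M]-component; the other condition uses the
     opposite choice. *)
  have := C _ _ _ _ _ _ _ _ _ (mem0v _) (mem0v _) zetak xi1 yj (mem0v _).
  by move/(congr1 (fun p : (L * M)%type => p.2)).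
apply: (bowtie_comp_compat (brM := brM)) => // i j k x y zeta xi1 yj zetak.
have := C _ _ _ _ _ _ _ _ _ xi1 yj (mem0v _) (mem0v _) (mem0v _) zetak.
by move/(congr1 (fun p : (L * M)%type => p.1)).
Qed.

End Bowtie.

(** * Actions dual to the adjoint action *)

Section DualAction.
Variable K : fieldType.
Variables (U W : superspace K) (B : U -> W -> K^o).
Variables (brU : U -> U -> U) (aU : 'End(U)) (aW : 'End(W)) (rho : U -> W -> W).
Hypotheses (Bp : perfect B) (Bp' : perfect (fun w u => B u w)) (Be : even_form B).
Hypothesis aB : forall u w, B (aU u) w = B u (aW w).
Hypotheses (hU : hom_lie_superalgebra brU aU) (mU : hl_multiplicative brU aU).
Hypotheses (admU : hl_admissible brU aU) (rb : bilin rho).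
Hypothesis rhoP : forall i j x y w, x \in part U i -> y \in part U j ->
  B (brU x y) w = - ((-1) ^+ (i && j) *: B y (rho x w)).

Lemma dual_actionE i j x y w : x \in part U i -> y \in part U j ->
  B y (rho x w) = - ((-1) ^+ (i && j) *: B (brU x y) w).
Proof. by move=> xi yj; rewrite (rhoP w xi yj) scalerN signrZK opprK. Qed.

(** By [rhoP], [B y (rho x w)] is up to sign [B (brU x y) w], which vanishes unless [y] has parity
    [i (+) j]. *)
Lemma dual_action_even : even_bilin rho.
Proof.
have [bb eU _ _ _] := hU.
move=> i j x w xi wj; apply: (even_part Bp') => [k l v u vk ul kl|k u uk kij].
  by apply: (Be ul vk); rewrite eq_sym.
have := rhoP w xi uk; rewrite (Be (eU _ _ _ _ xi uk) wj); last first.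
  by move: kij; case: (i); case: (j); case: (k).
by move/eqP; rewrite eq_sym oppr_eq0 => /eqP/(canRL (signrZK _)); rewrite scaler0.
Qed.

(** Admissibility as a rewrite rule: next to an entry in the image of [aU], a double twist can be
    erased or inserted. *)
Lemma adm_bracketr x y : brU (aU (aU x)) (aU y) = brU x (aU y).
Proof.
have [[bl br] _ _ _ _] := hU; apply/esym/eqP.
by rewrite -subr_eq0 -(linN (bl _)) -(linD (bl _)) admU.
Qed.

Lemma adm_bracketl x y : brU (aU x) (aU (aU y)) = brU (aU x) y.
Proof.
have [[bl br] _ ae sk _] := hU.
move: x; apply: (hom_lin_eq (V := U)) => [||i x xi].
- by apply: (comp_linear (f := fun v => brU v _)) => //; exact: lfun_linear.
- by apply: (comp_linear (f := fun v => brU v _)) => //; exact: lfun_linear.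
move: y; apply: (hom_lin_eq (V := U)) => [||j y yj] //.
- apply: (comp_linear (f := brU _)) => //.
  by apply: (comp_linear (f := aU)); exact: lfun_linear.
rewrite (sk _ _ _ _ (ae _ _ xi) (ae _ _ (ae _ _ yj))) adm_bracketr.
by rewrite -(sk _ _ _ _ (ae _ _ xi) yj).
Qed.

(** Puts [brU (aU x) y] in the image of [aU], so that [adm_bracketr] applies to nested brackets. *)
Lemma adm_twist x y : aU (brU x (aU y)) = brU (aU x) y.
Proof. by rewrite mU adm_bracketl. Qed.

(** The pairing is abstract so that [coad] (through [pairVD]) and [cocoad] (through [pairDV]) are
    both covered. Transposed to [U], the first condition is [adm_bracketr] and the second is
    Hom-Jacobi for [z], [aU x], [aU y]. *)
Lemma dual_action_rep : hl_representation brU aU aW rho.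
Proof.
have [[bl br] eU ae sk J] := hU; have [rl rr] := rb; have [[Bl Br] _ _] := Bp.
split=> // [|x w|i j x y w xi yj]; first exact: dual_action_even.
  move: x; apply: (hom_lin_eq (V := U)) => [||i x xi].
  - by apply: (comp_linear (f := fun v => rho v _)) => //; exact: lfun_linear.
  - by apply: (comp_linear (f := aW)) => //; exact: lfun_linear.
  apply: (perfect_inj Bp') => j y yj.
  rewrite (dual_actionE _ (ae _ _ xi) yj) -!aB (dual_actionE _ xi (ae _ _ yj)).
  by rewrite mU adm_bracketr.
apply: (perfect_inj Bp') => k z zk.
(* Hom-Jacobi yields outer entries twisted twice; [brU (aU x) z] is in the image of [aU], so
   admissibility supplies the missing twists. *)
have e1 : brU y (brU (aU x) z) = brU (aU (aU y)) (brU (aU x) z).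
  by rewrite -(adm_twist x z) adm_bracketr.
have e2 : brU x (brU (aU y) z) = brU (aU (aU x)) (brU (aU y) z).
  by rewrite -(adm_twist y z) adm_bracketr.
rewrite (linD (Br z)) (linN (Br z)) (linZ (Br z)).
rewrite (dual_actionE _ (eU _ _ _ _ xi yj) zk).
rewrite (dual_actionE _ (ae _ _ xi) zk) (dual_actionE _ yj (eU _ _ _ _ (ae _ _ xi) zk)).
rewrite (dual_actionE _ (ae _ _ yj) zk) (dual_actionE _ xi (eU _ _ _ _ (ae _ _ yj) zk)).
rewrite -aB mU (sk _ _ _ _ (ae _ _ (eU _ _ _ _ xi yj)) (ae _ _ zk)) mU.
rewrite (hom_jacobi hU zk (ae _ _ xi) (ae _ _ yj)) e1 e2.
rewrite (sk _ _ _ _ zk (ae _ _ xi)) (linN (br _)) (linZ (br _)).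
do !rewrite ?(linD (Bl w)) ?(linN (Bl w)) ?(linZ (Bl w)).
by case: i {xi}; case: j {yj}; case: k {zk}; rewrite ?expr0 ?expr1 !scaleKE /=; ring.
Qed.

End DualAction.

(** * The cocycle condition and the matched-pair compatibility *)

Section DualCompat.
Variable K : fieldType.
Variables (U W : superspace K) (B : U -> W -> K^o).
Variables (brU : U -> U -> U) (aU : 'End(U)) (rho : U -> W -> W).
Variables (brW : W -> W -> W) (aW : 'End(W)) (rho' : W -> U -> U).
Hypotheses (Bp : perfect B) (Bp' : perfect (fun w u => B u w)) (Be : even_form B).
Hypothesis aB : forall u w, B (aU u) w = B u (aW w).
Hypotheses (hU : hom_lie_superalgebra brU aU) (mU : hl_multiplicative brU aU).
Hypotheses (admU : hl_admissible brU aU) (rb : bilin rho).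
Hypotheses (hW : hom_lie_superalgebra brW aW) (mW : hl_multiplicative brW aW).
Hypotheses (admW : hl_admissible brW aW).
Hypothesis rhoP : forall i j x y w, x \in part U i -> y \in part U j ->
  B (brU x y) w = - ((-1) ^+ (i && j) *: B y (rho x w)).
Hypothesis rhoP' : forall i k x xi eta, x \in part U i -> xi \in part W k ->
  B (rho' xi x) eta = - ((-1) ^+ (i && k) *: B x (brW xi eta)).
Hypothesis re' : even_bilin rho'.

(** This is the pairing of [ad] of [aU x], applied to the cobracket of [y], with the wedge of
    [aW xi] and [eta], written out without exterior squares. *)
Definition dual_ad (i j k : bool) (x y : U) (xi eta : W) : K^o :=
  - ((-1) ^+ (i && j) *: (B y (brW (rho (aU x) (aW xi)) (aW eta))
     + (-1) ^+ (i && k) *: B y (brW (aW (aW xi)) (rho (aU x) eta)))).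

(** The common form of (C1), for [pairVD], and (C2), for [pairDV]. *)
Definition dual_cocycle : Prop :=
  forall i j k l (x y : U) (xi eta : W),
    x \in part U i -> y \in part U j -> xi \in part W k -> eta \in part W l ->
    B (brU x y) (brW (aW xi) eta) =
      dual_ad i j k x y xi eta - (-1) ^+ (i && j) *: dual_ad j i k y x xi eta.

Let rep := dual_action_rep Bp Bp' Be aB hU mU admU rb rhoP.

(** The transpose of [adm_twist]; it puts [rho (aU y) w] in the image of [aW]. *)
Lemma rho_twist y w : rho (aU y) w = aW (rho y (aW w)).
Proof.
have [[bl br] eU ae sk J] := hU; have [rl rr] := rb; have [[Bl Br] _ _] := Bp.
move: y; apply: (hom_lin_eq (V := U)) => [||i x xi].
- by apply: (comp_linear (f := fun v => rho v _)) => //; exact: lfun_linear.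
- by apply: (comp_linear (f := aW)) => //; exact: lfun_linear.
apply: (perfect_inj Bp') => j y yj.
rewrite (dual_actionE rhoP _ (ae _ _ xi) yj) -aB (dual_actionE rhoP _ xi (ae _ _ yj)) -aB.
by rewrite (adm_twist hU mU admU).
Qed.

Lemma dual_cocycle_term xi y eta :
  brW (aW (aW xi)) (rho (aU y) eta) = brW xi (rho (aU y) eta).
Proof. by rewrite rho_twist (adm_bracketr hW admW). Qed.

(** Transposing with [rhoP] and [rhoP'], the two [brU] terms give the second summands of the two
    [dual_ad], after [dual_cocycle_term] erases the double twist. The two [rho'] terms give the
    first summands, by multiplicativity and the equivariance of [rho]. *)
Lemma dual_compat_pair i j k l x y xi eta :
  x \in part U i -> y \in part U j -> xi \in part W k -> eta \in part W l ->
  B (brU (rho' xi x) (aU y) + (-1) ^+ (i && k) *: brU (aU x) (rho' xi y)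
      + (-1) ^+ ((i && j) + (j && k)) *: rho' (rho y xi) (aU x)
      - (-1) ^+ (i && k) *: rho' (rho x xi) (aU y)) eta =
  - ((-1) ^+ ((i (+) j) && k) *:
     (dual_ad i j k x y xi eta - (-1) ^+ (i && j) *: dual_ad j i k y x xi eta)).
Proof.
move=> xi1 yj xik etal.
have [[bl br] eU ae sk J] := hU; have [rl rr] := rb; have [[Bl Br] _ _] := Bp.
have [[bWl bWr] eW aWe skW _] := hW.
have [_ re A _] := rep.
rewrite (sk _ _ _ _ (re' xik xi1) (ae _ _ yj)).
do !rewrite ?(linD (Bl eta)) ?(linN (Bl eta)) ?(linZ (Bl eta)).
rewrite (rhoP _ (ae _ _ yj) (re' xik xi1)) (rhoP _ (ae _ _ xi1) (re' xik yj)).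
rewrite (rhoP' _ xi1 xik) (rhoP' _ yj xik).
rewrite (rhoP' _ (ae _ _ xi1) (re _ _ _ _ yj xik)) (rhoP' _ (ae _ _ yj) (re _ _ _ _ xi1 xik)).
rewrite !aB !mW -!A /dual_ad !dual_cocycle_term.
by case: i {xi1}; case: j {yj}; case: k {xik}; rewrite /= ?expr0 ?expr1 !scaleKE /=; ring.
Qed.

(** Paired with [eta], the left side of the compatibility condition becomes that of the cocycle
    condition by [rhoP'], with the same sign as in [dual_compat_pair]; cancelling this sign gives
    both directions. *)
Lemma dual_cocycle_compat : dual_cocycle <-> matched_compat aW brU aU rho' rho.
Proof.
have [[bl br] eU ae sk J] := hU; have [[bWl bWr] eW aWe skW _] := hW.
split=> [C i j k x y xi xi1 yj xik|C i j k l x y xi eta xi1 yj xik etal].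
  apply: (perfect_inj Bp) => l eta etal.
  rewrite (dual_compat_pair xi1 yj xik etal) -(C _ _ _ _ _ _ _ _ xi1 yj xik etal).
  exact: rhoP' (eU _ _ _ _ xi1 yj) (aWe _ _ xik).
apply: (can_inj (signrZK ((i (+) j) && k))); apply: oppr_inj.
rewrite -(dual_compat_pair xi1 yj xik etal) -(C _ _ _ _ _ _ xi1 yj xik).
by rewrite (rhoP' _ (eU _ _ _ _ xi1 yj) (aWe _ _ xik)).
Qed.

End DualCompat.

(** * The standard bilinear form *)

Section Duality.
Variables (K : fieldType) (V : superspace K).

(** [cocoad] is defined through [pairDV] and [coad] through [pairVD]; this carries each defining
    relation over to the opposite pairing, as [rhoP'] requires. *)
Lemma dual_action_flip (U W : superspace K) (B : U -> W -> K^o) (B' : W -> U -> K^o)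
    (brW : W -> W -> W) (rho' : W -> U -> U) :
  bilin B -> bilin brW -> even_bilin brW -> even_bilin rho' ->
  (forall i j u w, u \in part U i -> w \in part W j ->
     B u w = (-1) ^+ (i && j) *: B' w u) ->
  (forall k l xi eta x, xi \in part W k -> eta \in part W l ->
     B' (brW xi eta) x = - ((-1) ^+ (k && l) *: B' eta (rho' xi x))) ->
  forall i k x xi eta, x \in part U i -> xi \in part W k ->
    B (rho' xi x) eta = - ((-1) ^+ (i && k) *: B x (brW xi eta)).
Proof.
move=> [Bl Br] [bl br] eW re' BB' P i k x xi eta xi1 xik.
move: eta; apply: (hom_lin_eq (V := W)) => [||l eta etal]; first exact: Br.
  by apply/opp_linear/scale_linear/(comp_linear (f := B x)).
rewrite (BB' _ _ _ _ (re' _ _ _ _ xik xi1) etal).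
rewrite (BB' _ _ _ _ xi1 (eW _ _ _ _ xik etal)) (P _ _ _ _ _ xik etal).
by case: i {xi1}; case: k {xik}; case: l {etal}; rewrite /= ?expr0 ?expr1 !scaleKE /=; ring.
Qed.

Lemma pairDVE i j (x : V) (xi : dual V) : xi \in part (dual V) j -> x \in part V i ->
  pairDV xi x = (-1) ^+ (j && i) *: pairVD x xi.
Proof. by move=> xij xi1; rewrite (pairVDE xi1 xij) andbC signrZK. Qed.

Lemma pairVD_dual_map (al : 'End(V)) x xi : even_map al ->
  pairVD (al x) xi = pairVD x (dual_map al xi).
Proof.
move=> ae; have [L R] := pairVD_bilin V.
move: x; apply: (hom_lin_eq (V := V)) => [||i x xi1].
- by apply: (comp_linear (f := fun v => pairVD v _)) => //; exact: lfun_linear.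
- exact: L.
by rewrite (pairVD_hom _ (ae _ _ xi1)) (pairVD_hom _ xi1) dual_mapE.
Qed.

Lemma std_form_bilin : bilin (@std_form K V).
Proof.
have [L R] := pairVD_bilin V; have [L' R'] := pairDV_bilin V.
by split=> -[z zeta] a [u w] [u' w'];
  rewrite /std_form /= ?L ?R ?L' ?R' scalerDr addrACA.
Qed.

(** Here and in the next three lemmas, pairing with a vector of one summand reads off the component
    in the other. *)
Lemma std_form_inr (p : dsum V (dual V)) (zeta : dual V) :
  std_form p ((0, zeta) : dsum V (dual V)) = pairVD (p : (V * dual V)%type).1 zeta.
Proof. by have [L R] := pairDV_bilin V; rewrite /std_form /= (lin0 (R _)) addr0. Qed.

Lemma std_form_inl (p : dsum V (dual V)) (z : V) :
  std_form ((z, 0) : dsum V (dual V)) p = pairVD z (p : (V * dual V)%type).2.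
Proof. by have [L R] := pairDV_bilin V; rewrite /std_form /= (lin0 (L _)) addr0. Qed.

Lemma std_form_inr_l (p : dsum V (dual V)) (zeta : dual V) :
  std_form ((0, zeta) : dsum V (dual V)) p = pairDV zeta (p : (V * dual V)%type).1.
Proof. by have [L R] := pairVD_bilin V; rewrite /std_form /= (lin0 (L _)) add0r. Qed.

Lemma std_form_inl_r (p : dsum V (dual V)) (z : V) :
  std_form p ((z, 0) : dsum V (dual V)) = pairDV (p : (V * dual V)%type).2 z.
Proof. by have [L R] := pairVD_bilin V; rewrite /std_form /= (lin0 (R _)) add0r. Qed.

Lemma std_form_sym i j (p q : dsum V (dual V)) :
  p \in part (dsum V (dual V)) i -> q \in part (dsum V (dual V)) j ->
  std_form p q = (-1) ^+ (i && j) *: std_form q p.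
Proof.
case: p q => [x xi] [y eta] /dsum_pairP[xi1 xii] /dsum_pairP[yj etaj].
rewrite /std_form /= (pairDVE xii yj) (pairVDE xi1 etaj) addrC scalerDr.
by congr (_ + _); rewrite (pairDVE xii yj) andbC signrZK.
Qed.

(* Two brackets invariant under the standard form that agree on the two
   isotropic summands differ by an invariant D vanishing on both summands, and
   then S(D(x, xi), zeta) = S(x, D(xi, zeta)) = 0, S(z, D(x, xi)) =
   S(D(z, x), xi) = 0, and symmetrically for D(xi, x). *)
Lemma invariant_bracket_uniq (b b' : dsum V (dual V) -> dsum V (dual V) -> dsum V (dual V)) :
  bilin b -> bilin b' ->
  (forall p q r, std_form (b p q) r = std_form p (b q r)) ->
  (forall p q r, std_form (b' p q) r = std_form p (b' q r)) ->
  (forall x y : V, b (x, 0) (y, 0) = b' (x, 0) (y, 0)) ->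
  (forall xi eta : dual V, b (0, xi) (0, eta) = b' (0, xi) (0, eta)) ->
  forall p q, b p q = b' p q.
Proof.
move=> [bl br] [bl' br'] inv inv' e1 e2.
have lr (x : V) (xi : dual V) : b (x, 0) (0, xi) = b' (x, 0) (0, xi).
  apply: pair_ext.
    apply: (perfect_inj (pairVD_perfect V)) => j zeta _.
    by rewrite -!std_form_inr inv inv' e2.
  apply: (perfect_inj (pairVD_opp_perfect V)) => j z _.
  by rewrite -!std_form_inl -inv -inv' e1.
have rl (x : V) (xi : dual V) : b (0, xi) (x, 0) = b' (0, xi) (x, 0).
  apply: pair_ext.
    apply: (perfect_inj (pairDV_opp_perfect V)) => j zeta _.
    by rewrite -!std_form_inr_l -inv -inv' e2.
  apply: (perfect_inj (pairDV_perfect V)) => j z _.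
  by rewrite -!std_form_inl_r inv inv' e1.
have split2 (x : V) (xi : dual V) : ((x, xi) : dsum V (dual V)) = (x, 0) + (0, xi).
  by apply: pair_ext; rewrite /= ?addr0 ?add0r.
move=> [x xi] [y eta]; rewrite (split2 x xi) (split2 y eta).
by rewrite !(linD (bl _), linD (br _), linD (bl' _), linD (br' _)) e1 e2 lr rl.
Qed.

(** * Coadjoint maps and invariance of the standard form *)

Variables (br : V -> V -> V) (al : 'End(V)) (brd : dual V -> dual V -> dual V).
Hypotheses (hg : hom_lie_superalgebra br al) (hd : hom_lie_superalgebra brd (dual_map al)).

Lemma coad_even : even_bilin (coad br).
Proof.
have [bb _ _ _ _] := hg.
by apply: (dual_action_even (pairVD_opp_perfect V) (@pairVD_even K V) hg) => *; exact: coadP.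
Qed.

Lemma cocoad_even : even_bilin (cocoad brd).
Proof.
have [bb _ _ _ _] := hd.
by apply: (dual_action_even (pairDV_opp_perfect V) (@pairDV_even K V) hd) => *; exact: cocoadP.
Qed.

Lemma pairVD_cocoad i k x xi eta : x \in part V i -> xi \in part (dual V) k ->
  pairVD (cocoad brd xi x) eta = - ((-1) ^+ (i && k) *: pairVD x (brd xi eta)).
Proof.
have [bb eb _ _ _] := hd; apply: dual_action_flip => //; first exact: pairVD_bilin.
- exact: cocoad_even.
- exact: pairVDE.
- by move=> *; exact: cocoadP.
Qed.

Lemma pairDV_coad i k xi x y : xi \in part (dual V) i -> x \in part V k ->
  pairDV (coad br x xi) y = - ((-1) ^+ (i && k) *: pairDV xi (br x y)).
Proof.
have [bb eb _ _ _] := hg; apply: dual_action_flip => //; first exact: pairDV_bilin.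
- exact: coad_even.
- by move=> a b u w; exact: pairDVE.
- by move=> *; exact: coadP.
Qed.

(** On homogeneous vectors, the relations defining [coad] and [cocoad] turn every mixed term into
    the pairing of a bracket within one summand with a vector of the other. Skew-symmetry then
    matches the two sides. *)
Lemma std_form_invariant p q r :
  let b := bowtie br brd (coad br) (cocoad brd) in
  std_form (b p q) r = std_form p (b q r).
Proof.
have [bb eb _ sk _] := hg; have [bd ed _ skd _] := hd.
have [SL SR] := std_form_bilin; have [L R] := pairVD_bilin V.
have cb := coad_bilin bb; have cb' := cocoad_bilin bd.
move=> b; have [bl brr] : bilin b by exact: bowtie_bilin.
have P' i j x y w := @dual_actionE _ _ _ _ _ _ (fun i j x y w => @cocoadP _ V brd i j x y w bd) i j x y w.
have P i j x y w := @dual_actionE _ _ _ _ _ _ (fun i j x y w => @coadP _ V br i j x y w bb) i j x y w.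
move: p; apply: (hom_lin_eq (V := dsum V (dual V))) => [||i [x xi]].
- by apply: (comp_linear (f := fun v => std_form v _)).
- exact: SL.
move=> /dsum_pairP[xi1 xii].
move: q; apply: (hom_lin_eq (V := dsum V (dual V))) => [||j [y eta]].
- by apply: (comp_linear (f := fun v => std_form v _)).
- by apply: (comp_linear (f := fun v => std_form _ v)).
move=> /dsum_pairP[yj etaj].
move: r; apply: (hom_lin_eq (V := dsum V (dual V))) => [||k [z zeta]].
- exact: SR.
- by apply: (comp_linear (f := fun v => std_form _ v)).
move=> /dsum_pairP[zk zetak].
rewrite /b (bowtie_hom _ _ cb cb' xi1 xii yj etaj) (bowtie_hom _ _ cb cb' yj etaj zk zetak).
rewrite /std_form /bowtie_comp /=.
have [L' R'] := pairDV_bilin V.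
do !rewrite ?(linD (L _)) ?(linN (L _)) ?(linZ (L _)) ?(linD (R _)) ?(linN (R _))
  ?(linZ (R _)) ?(linD (L' _)) ?(linN (L' _)) ?(linZ (L' _)) ?(linD (R' _))
  ?(linN (R' _)) ?(linZ (R' _)).
rewrite (pairVD_cocoad _ yj xii) (pairVD_cocoad _ xi1 etaj).
rewrite (pairDV_coad _ etaj xi1) (pairDV_coad _ xii yj).
rewrite (P _ _ _ _ _ yj xi1) (P _ _ _ _ _ zk xi1) (P' _ _ _ _ _ etaj xii) (P' _ _ _ _ _ zetak xii).
rewrite (pairDVE etaj (eb _ _ _ _ xi1 zk)) (pairDVE (ed _ _ _ _ zetak xii) yj).
rewrite (sk _ _ _ _ yj xi1) (sk _ _ _ _ zk xi1) (skd _ _ _ _ etaj xii) (skd _ _ _ _ zetak xii).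
do !rewrite ?(linN (L _)) ?(linZ (L _)) ?(linN (R _)) ?(linZ (R _)) ?(linN (L' _))
  ?(linZ (L' _)).
case: i {xi1 xii}; case: j {yj etaj}; case: k {zk zetak}; rewrite /= ?expr0 ?expr1 !scaleKE /=.
all: ring.
Qed.

End Duality.

(** * Superbialgebras, matched pairs and Manin supertriples *)

Section Superbialgebra.
Variables (K : fieldType) (V : superspace K).
Variables (br : V -> V -> V) (al : 'End(V)) (brd : dual V -> dual V -> dual V).
Hypothesis K0 : [pchar K] =i pred0.
Hypotheses (hg : hom_lie_superalgebra br al) (mg : hl_multiplicative br al).
Hypothesis admg : hl_admissible br al.
Hypothesis hd : hom_lie_superalgebra brd (dual_map al).
Hypothesis md : hl_multiplicative brd (dual_map al).
Hypothesis admd : hl_admissible brd (dual_map al).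

(** Duality moves [ad2] onto the wedge, where it expands into two wedges, and each is evaluated by
    the defining property of the cobracket. *)
Lemma superbialgebra_C1E : superbialgebra_C1 br al brd <->
  dual_cocycle (@pairVD K V) br al (coad br) brd (dual_map al).
Proof.
have [bb eb ae sk _] := hg; have [bd ed aed skd _] := hd.
have [[_ pr] _ _] := pairVD2_perfect K0 V.
have cP u v w : pairVD2 (cobr brd u) (wedge v w) = pairVD u (brd v w).
  exact: cobrP.
have E i j k x y xi eta : x \in part V i -> y \in part V j -> xi \in part (dual V) k ->
    pairVD2 (ad2 br al (al x) (cobr brd y)) (wedge (dual_map al xi) eta) =
    dual_ad (@pairVD K V) al (coad br) brd (dual_map al) i j k x y xi eta.
  move=> xi1 yj xik.
  (* The cobracket is even, so that of [y] has parity [j], which fixes the sign. *)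
  rewrite (ad2P K0 _ _ bb (ae _ _ xi1) (cobr_even K0 bd skd ed yj)).
  rewrite (ext2_act_wedge K0 (coad_bilin bb) (coad_even hg) aed _ (ae _ _ xi1) (aed _ _ xik)).
  congr (- (_ *: _)).
  apply: etrans (linD (pr _) _ _) _; congr (_ + _); first exact: cP.
  apply: etrans (linZ (pr _) _ _) _; congr (_ *: _); exact: cP.
split=> C i j k l x y xi eta xi1 yj xik etal.
  have := C _ _ _ _ _ _ _ _ xi1 yj xik etal; rewrite cP => ->.
  by congr (_ - _ *: _); apply: E.
rewrite cP (C _ _ _ _ _ _ _ _ xi1 yj xik etal).
by congr (_ - _ *: _); apply/esym; apply: E.
Qed.

Lemma superbialgebra_C2E : superbialgebra_C2 br al brd <->
  dual_cocycle (@pairDV K V) brd (dual_map al) (cocoad brd) br al.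
Proof.
have [bb eb ae sk _] := hg; have [bd ed aed skd _] := hd.
have [[_ pr] _ _] := pairDV2_perfect K0 V.
have cP u v w : pairDV2 (dual_cobr br u) (wedge v w) = pairDV u (br v w).
  exact: dual_cobrP.
have E i j k xi eta x y : xi \in part (dual V) i -> eta \in part (dual V) j -> x \in part V k ->
    pairDV2 (coad2 al brd (dual_map al xi) (dual_cobr br eta)) (wedge (al x) y) =
    dual_ad (@pairDV K V) (dual_map al) (cocoad brd) br al i j k xi eta x y.
  move=> xi1 yj xik.
  rewrite (coad2P K0 _ _ bd (aed _ _ xi1) (dual_cobr_even K0 bb sk eb yj)).
  rewrite (ext2_act_wedge K0 (cocoad_bilin bd) (cocoad_even hd) ae _ (aed _ _ xi1) (ae _ _ xik)).
  congr (- (_ *: _)).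
  apply: etrans (linD (pr _) _ _) _; congr (_ + _); first exact: cP.
  apply: etrans (linZ (pr _) _ _) _; congr (_ *: _); exact: cP.
split=> C i j k l x y xi eta xi1 yj xik etal.
  have := C _ _ _ _ _ _ _ _ xi1 yj xik etal; rewrite cP => ->.
  by congr (_ - _ *: _); apply: E.
rewrite cP (C _ _ _ _ _ _ _ _ xi1 yj xik etal).
by congr (_ - _ *: _); apply/esym; apply: E.
Qed.

Let VDp := pairVD_perfect V.
Let VDp' := pairVD_opp_perfect V.
Let DVp := pairDV_perfect V.
Let DVp' := pairDV_opp_perfect V.

Lemma superbialgebra_C1_compat : superbialgebra_C1 br al brd <->
  matched_compat (dual_map al) br al (cocoad brd) (coad br).
Proof.
have [bb eb ae sk _] := hg; rewrite superbialgebra_C1E.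
apply: (dual_cocycle_compat VDp VDp' (@pairVD_even K V)) => //.
- by move=> u w; exact: pairVD_dual_map.
- exact: coad_bilin.
- by move=> *; exact: coadP.
- by move=> *; exact: (pairVD_cocoad hd).
- exact: (cocoad_even hd).
Qed.

Lemma superbialgebra_C2_compat : superbialgebra_C2 br al brd <->
  matched_compat al brd (dual_map al) (coad br) (cocoad brd).
Proof.
have [bd ed aed skd _] := hd; rewrite superbialgebra_C2E.
apply: (dual_cocycle_compat DVp DVp' (@pairDV_even K V)) => //.
- by move=> u w; rewrite dual_mapE.
- exact: cocoad_bilin.
- by move=> *; exact: cocoadP.
- by move=> *; exact: (pairDV_coad hg).
- exact: (coad_even hg).
Qed.

Lemma coad_rep : hl_representation br al (dual_map al) (coad br).
Proof.
have [bb eb ae sk _] := hg.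
apply: (dual_action_rep VDp VDp' (@pairVD_even K V)) => //.
- by move=> u w; exact: pairVD_dual_map.
- exact: coad_bilin.
- by move=> *; exact: coadP.
Qed.

Lemma cocoad_rep : hl_representation brd (dual_map al) al (cocoad brd).
Proof.
have [bd ed aed skd _] := hd.
apply: (dual_action_rep DVp DVp' (@pairDV_even K V)) => //.
- by move=> u w; rewrite dual_mapE.
- exact: cocoad_bilin.
- by move=> *; exact: cocoadP.
Qed.

(** (C1) and (C2) are the two compatibility conditions; the representation conditions are [coad_rep]
    and [cocoad_rep]. *)
Lemma superbialgebra_matched_pair : hom_lie_superbialgebra br al brd <->
  matched_pair br al brd (dual_map al) (coad br) (cocoad brd).
Proof.
rewrite /hom_lie_superbialgebra superbialgebra_C1_compat superbialgebra_C2_compat.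
split=> [[c c']|[_ _ _ c c']] //; split=> //; [exact: coad_rep | exact: cocoad_rep].
Qed.

Lemma matched_pair_manin :
  matched_pair br al brd (dual_map al) (coad br) (cocoad brd) ->
  manin_supertriple (bowtie br brd (coad br) (cocoad brd)) (dsum_map al (dual_map al))
    br al brd (dual_map al) (dsum_inl V (dual V)) (dsum_inr V (dual V)) (@std_form K V).
Proof.
move=> mp; have [bb eb ae sk _] := hg; have [bd ed aed skd _] := hd.
have cb := coad_bilin bb; have cb' := cocoad_bilin bd.
have inlE x : dsum_inl V (dual V) x = (x, 0) by exact: dsum_inlE.
have inrE x : dsum_inr V (dual V) x = (0, x) by exact: dsum_inrE.
have [VDl VDr] := pairVD_bilin V; have [DVl DVr] := pairDV_bilin V.
split; first by split=> //; exact: matched_pair_hom_lie.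
(* For nondegeneracy, testing against each summand kills the component in the other. *)
- split; [exact: std_form_bilin | by move=> *; exact: std_form_sym | move=> v v0].
  apply: pair_ext.
    apply: (perfect_inj VDp) => j zeta _.
    by rewrite -std_form_inr v0 (lin0 (VDl _)).
  apply: (perfect_inj DVp) => j z _.
  by rewrite -std_form_inl_r v0 (lin0 (DVl _)).
- split=> [p q r|[x xi] [y eta]]; first exact: (std_form_invariant hg hd).
  rewrite !dsum_mapE /std_form /=; congr (_ + _); first exact: pairVD_dual_map.
  exact: dual_mapE.
- split.
  + split=> [x y|i x xi1|x y|x].
    * by rewrite !inlE => -[].
    * by rewrite inlE; apply/dsum_pairP; rewrite xi1 mem0v.
    * by rewrite !inlE bowtie_inl.
    * by rewrite !inlE dsum_mapE linear0.
  + split=> [x y|i x xi1|x y|x].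
    * by rewrite !inrE => -[].
    * by rewrite inrE; apply/dsum_pairP; rewrite xi1 mem0v.
    * by rewrite !inrE bowtie_inr.
    * by rewrite !inrE dsum_mapE linear0.
  + by move=> x y; rewrite !inlE std_form_inl /= (lin0 (VDr _)).
  + by move=> x y; rewrite !inrE std_form_inr /= (lin0 (VDl _)).
split.
  apply/vspaceP => -[x xi]; rewrite memvf; apply/memv_addP.
  exists (x, 0); first by rewrite -inlE memv_img ?memvf.
  exists (0, xi); first by rewrite -inrE memv_img ?memvf.
  by apply: pair_ext; rewrite /= ?addr0 ?add0r.
apply/vspaceP => p; rewrite memv0 memv_cap; apply/andP/eqP => [[]|->].
  by move=> /memv_imgP[x _ ->] /memv_imgP[xi _]; rewrite inlE inrE => -[-> _].
by rewrite !mem0v.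
Qed.

(** The given bracket is the bicrossed one by [invariant_bracket_uniq], and [phi] is determined by
    its restrictions to the two summands. The Hom-Lie axioms then transfer. *)
Lemma manin_bowtie (brM : dsum V (dual V) -> dsum V (dual V) -> dsum V (dual V))
    (phi : 'End(dsum V (dual V))) :
  manin_supertriple brM phi br al brd (dual_map al)
    (dsum_inl V (dual V)) (dsum_inr V (dual V)) (@std_form K V) ->
  hom_lie_superalgebra (bowtie br brd (coad br) (cocoad brd)) (dsum_map al (dual_map al)).
Proof.
have [bb eb ae sk _] := hg; have [bd ed aed skd _] := hd.
have cb := coad_bilin bb; have cb' := cocoad_bilin bd.
have inlE x : dsum_inl V (dual V) x = (x, 0) by exact: dsum_inlE.
have inrE x : dsum_inr V (dual V) x = (0, x) by exact: dsum_inrE.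
move=> [[[bM eM aM sM J] _ _] _ [inv _] [[_ _ l1 l2] [_ _ r1 r2] _ _] _].
have E : forall p q, brM p q = bowtie br brd (coad br) (cocoad brd) p q.
  apply: invariant_bracket_uniq => //.
  - exact: bowtie_bilin.
  - exact: (std_form_invariant hg hd).
  - by move=> x y; rewrite -!inlE -l1 !inlE bowtie_inl.
  - by move=> x y; rewrite -!inrE -r1 !inrE bowtie_inr.
have phiE p : phi p = dsum_map al (dual_map al) p.
  case: p => x xi; rewrite dsum_mapE.
  have -> : (x, xi) = dsum_inl V (dual V) x + dsum_inr V (dual V) xi.
    by rewrite inlE inrE; apply: pair_ext; rewrite /= ?addr0 ?add0r.
  apply: etrans (linD (lfun_linear phi) _ _) _.
  apply: etrans (congr2 +%R (esym (l2 x)) (esym (r2 xi))) _; rewrite inlE inrE.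
  by apply: pair_ext; rewrite /= ?addr0 ?add0r.
split=> [|i j p q|i p|i j p q|i j k p q r pi pj pk].
- exact: bowtie_bilin.
- by rewrite -E; exact: eM.
- by rewrite -phiE; exact: aM.
- by rewrite -!E; exact: sM.
- by rewrite -!E -!phiE; exact: J.
Qed.

Lemma matched_pair_manin_supertriple :
  matched_pair br al brd (dual_map al) (coad br) (cocoad brd) <->
  exists (brM : dsum V (dual V) -> dsum V (dual V) -> dsum V (dual V))
         (phi : 'End(dsum V (dual V))),
    manin_supertriple brM phi br al brd (dual_map al)
      (dsum_inl V (dual V)) (dsum_inr V (dual V)) (@std_form K V).
Proof.
split=> [mp|[brM [phi /manin_bowtie hb]]].
  by exists (bowtie br brd (coad br) (cocoad brd)), (dsum_map al (dual_map al));
     exact: matched_pair_manin.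
have [c c'] : matched_compat al brd (dual_map al) (coad br) (cocoad brd) /\
    matched_compat (dual_map al) br al (cocoad brd) (coad br).
  have [bb _ _ _ _] := hg; have [bd _ _ _ _] := hd; apply: hom_lie_bowtie_compat => //.
  - exact: coad_bilin.
  - exact: (coad_even hg).
  - exact: cocoad_bilin.
  - exact: (cocoad_even hd).
by split=> //; [exact: coad_rep | exact: cocoad_rep].
Qed.

End Superbialgebra.

Theorem theorem2p11 (K : fieldType) (K0 : [pchar K] =i pred0)
    (g : superspace K) (br : g -> g -> g) (al : 'End(g))
    (brd : dual g -> dual g -> dual g)
    (hg : hom_lie_superalgebra br al)
    (hg_mult : hl_multiplicative br al)
    (hg_adm : hl_admissible br al)
    (hd : hom_lie_superalgebra brd (dual_map al))
    (hd_mult : hl_multiplicative brd (dual_map al))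
    (hd_adm : hl_admissible brd (dual_map al)) :
  (hom_lie_superbialgebra br al brd <->
     matched_pair br al brd (dual_map al) (coad br) (cocoad brd)) /\
  (matched_pair br al brd (dual_map al) (coad br) (cocoad brd) <->
     exists (brM : dsum g (dual g) -> dsum g (dual g) -> dsum g (dual g))
            (phi : 'End(dsum g (dual g))),
       manin_supertriple brM phi br al brd (dual_map al)
         (dsum_inl g (dual g)) (dsum_inr g (dual g)) (@std_form K g)).
Proof.
split; first exact: superbialgebra_matched_pair.
exact: matched_pair_manin_supertriple.
Qed.
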